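(* Consider the finite-horizon stochastic optimal control problem, the functions $f_\theta$, the risk $\mathcal R^\pi(s)$, and the values $V_0^{\pi,\theta}(s)$ described in the context, with initial state $s\in\mathcal S_0$. Let $\theta^*$ be an optimal solution of $\min_{\theta\in\Theta}\min_{\pi\in\Pi(\mathcal M)}V_0^{\pi,\theta}(s)$. Let $\tilde V^{\theta^*}_t$, $0\le t\le T$, be defined by $\tilde V^{\theta^*}_T(s',x)=\min_{a\in\mathcal A_T}\tilde c^{\theta^*}_T(s',x,a)$ and, for $0\le t\le T-1$, $(s',x)\in\mathcal S_t\times\mathcal X_t$, $$\tilde V^{\theta^*}_t(s',x)=\min_{a\in\mathcal A_t}\Big\{\tilde c^{\theta^*}_t(s',x,a)+\mathbb E_{\xi\sim P_t}\big[\tilde V^{\theta^*}_{t+1}(\tilde F_t(s',x,a,\xi))\big]\Big\},$$ and let $\pi^{\theta^*}$ be a policy that at stage $t$ in augmented state $(s',x)$ selects an action attaining this minimum. Then $$\min_{\pi\in\Pi(\mathcal M)}\mathcal R^\pi(s)=\tilde V^{\theta^*}_0(s,0)+f_{\theta^*}(0),$$ and $\pi^{\theta^*}$ is an optimal policy for $\min_{\pi\in\Pi(\mathcal M)}\mathcal R^\pi(s)$.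
   Context: Stochastic optimal control (SOC) problem: $T$ is a positive integer; for $0\le t\le T$, $\mathcal S_t\subseteq\mathbb R^{d_{\mathcal S}}$ is a compact state space, $\mathcal A_t\subseteq\mathbb R^{d_{\mathcal A}}$ a compact control space, $c_t:\mathcal S_t\times\mathcal A_t\to[0,1]$ a continuous cost; for $0\le t\le T-1$, $F_t:\mathcal S_t\times\mathcal A_t\times\Xi_t\to\mathcal S_{t+1}$ is a continuous transition function and the noise $\xi_t\in\Xi_t$ has distribution $P_t$, not depending on state or action; $\xi_0,\dots,\xi_{T-1}$ are independent. $S_{t+1}=F_t(S_t,A_t,\xi_t)$. $\Pi(\mathcal M)$ is the set of randomized history-dependent policies: $A_t\sim\pi(\cdot|H_t)$ with history $H_t=\xi_{[t-1]}=(\xi_0,\dots,\xi_{t-1})$. $\mathbb E^\pi_P$ is the corresponding expectation. Risk: $\Theta\subseteq\mathbb R^{d_\Theta}$, $f_\theta:\mathbb R\to\mathbb R$; $V_0^{\pi,\theta}(s)=\mathbb E^\pi_P[f_\theta(\sum_{t=0}^Tc_t(S_t,A_t))\mid S_0=s]$ and $\mathcal R^\pi(s)=\min_{\theta\in\Theta}V_0^{\pi,\theta}(s)$. Standing assumption: $|f_\theta(z)-f_\theta(z')|\le L_C|z-z'|$ and $|f_\theta(z)-f_{\theta'}(z)|\le L_\Theta\|\theta-\theta'\|$ for all $z,z'\in[0,T+1]$, $\theta,\theta'\in\Theta$; $\Theta$ is bounded with radius $R_\Theta$. Augmentation: $\mathcal X_t=[0,t]$, $\tilde c^\theta_t(s,x,a)=f_\theta(x+c_t(s,a))-f_\theta(x)$,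 $\tilde F_t(s,x,a,\xi)=(F_t(s,a,\xi),\,x+c_t(s,a))$. The augmented variable starts at $X_0=0$ and $X_{t+1}=X_t+c_t(S_t,A_t)$. *)

(* Defs.v *)
From HB Require Import structures.
From mathcomp Require Export all_boot all_order all_algebra.
From mathcomp Require Export all_classical all_reals all_analysis.
From mathcomp Require Export measurable_realfun.

Set Implicit Arguments.
Unset Strict Implicit.
Unset Printing Implicit Defensive.

Import Order.TTheory GRing.Theory Num.Theory.
Export numFieldNormedType.Exports.

#[global] Open Scope classical_set_scope.
#[global] Open Scope ring_scope.

Definition borel (X : ptopologicalType) := g_sigma_algebraType (@open X).

Section measurable_tuples.
Context d d' (X : measurableType d) (Y : measurableType d').

Definition rcons_pair n (w : n.-tuple (X * Y) * X * Y) :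
    n.+1.-tuple (X * Y) :=
  rcons_tuple w.1.1 (w.1.2, w.2).

Lemma measurable_rcons_pair n :
  measurable_fun [set: n.-tuple (X * Y) * X * Y] (@rcons_pair n).
Proof.
apply/measurable_fun_tnthP => i.
have [lt_in|le_ni] := ltnP i n.
  rewrite (_ : _ \o _ = (fun t => tnth t (Ordinal lt_in)) \o (fst \o fst)).
    apply: measurableT_comp; first exact: measurable_tnth.
    exact: measurableT_comp.
  apply/funext => -[[t x] y] /=.
  by rewrite !(tnth_nth (x, y)) /= nth_rcons size_tuple lt_in.
rewrite (_ : _ \o _ = (fun w => (w.1.2, w.2))).
  by apply: measurable_fun_pair => //; exact: measurableT_comp.
apply/funext => -[[t x] y] /=.
have -> : i = ord_max by apply/val_inj/eqP; rewrite eqn_leq le_ni -ltnS ltn_ord.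
by rewrite (tnth_nth (x, y)) /= nth_rcons size_tuple ltnn eqxx.
Qed.

HB.instance Definition _ n :=
  isMeasurableFun.Build _ _ _ _ (@rcons_pair n) (@measurable_rcons_pair n).

Definition snd_tup n (t : n.-tuple (X * Y)) : n.-tuple Y := map_tuple snd t.

Lemma measurable_snd_tup n :
  measurable_fun [set: n.-tuple (X * Y)] (@snd_tup n).
Proof.
apply/measurable_fun_tnthP => i.
rewrite (_ : _ \o _ = snd \o (@tnth n _)^~ i); last first.
  by apply/funext => t /=; rewrite tnth_map.
by apply: measurableT_comp => //; exact: measurable_tnth.
Qed.

End measurable_tuples.

Section kernel_pullback.
Context d d' d'' (X : measurableType d) (Y : measurableType d')
  (Z : measurableType d'') (R : realType).
Variables (k : R.-pker Y ~> Z) (f : X -> Y).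
Hypothesis mf : measurable_fun [set: X] f.

Definition kpullback of measurable_fun [set: X] f :
  X -> {measure set Z -> \bar R} := fun x => k (f x).

Let measurable_kpullback U : measurable U ->
  measurable_fun [set: X] (kpullback mf ^~ U).
Proof.
move=> mU; apply: (@measurableT_comp _ _ _ _ _ _ (k ^~ U)) => //.
exact: measurable_kernel.
Qed.

HB.instance Definition _ :=
  isKernel.Build _ _ _ _ _ (kpullback mf) measurable_kpullback.

Let kpullback_prob x : kpullback mf x [set: Z] = 1%E.
Proof. exact: prob_kernel. Qed.

HB.instance Definition _ :=
  Kernel_isProbability.Build _ _ _ _ _ (kpullback mf) kpullback_prob.

End kernel_pullback.

(* The joint law of (x, y) where x ~ mu and y ~ k x given x. *)
Section semidirect.
Context d d' (X : measurableType d) (Y : measurableType d') (R : realType).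
Variables (mu : probability X R) (k : R.-pker X ~> Y).
Local Open Scope ereal_scope.

Definition semidirect (U : set (X * Y)) : \bar R :=
  \int[mu]_x k x (xsection U x).

Let semidirect0 : semidirect set0 = 0.
Proof. by apply: integral0_eq => x _; rewrite xsection0 measure0. Qed.

Let semidirect_ge0 U : 0 <= semidirect U.
Proof. by apply: integral_ge0 => x _; exact: measure_ge0. Qed.

Let semidirect_sigma_additive : semi_sigma_additive semidirect.
Proof.
move=> U mU tU mUU.
rewrite [X in _ --> X](_ : _ = \sum_(0 <= n <oo) semidirect (U n)).
  by apply: is_cvg_nneseries => n _ _; exact: semidirect_ge0.
rewrite /semidirect -integral_nneseries//.
- apply: eq_integral => x _; rewrite xsection_bigcup.
  rewrite measure_semi_bigcup//.
  + by move=> n; exact: measurable_xsection.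
  + exact: trivIset_xsection.
  + by rewrite -xsection_bigcup; exact: measurable_xsection.
- by move=> n; apply: measurable_fun_xsection_finite_kernel; rewrite inE.
Qed.

HB.instance Definition _ := isMeasure.Build _ _ _ semidirect
  semidirect0 semidirect_ge0 semidirect_sigma_additive.

Let semidirect_setT : semidirect setT = 1.
Proof.
rewrite /semidirect -(probability_setT mu) -[RHS]mul1e -integral_cst//.
apply: eq_integral => x _.
by rewrite (_ : xsection _ _ = setT) ?prob_kernel//; apply/seteqP; split => // y _;
   rewrite /xsection/= inE.
Qed.

HB.instance Definition _ :=
  Measure_isProbability.Build _ _ _ semidirect semidirect_setT.

End semidirect.

Definition is_minimum (R : realType) (E : set R) (m : R) : Prop :=
  E m /\ lbound E m.

Definition euclidean_norm (R : realType) n (v : 'rV[R]_n) : R :=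
  Num.sqrt (\sum_i v ord0 i ^+ 2).

(* All maps are total on the ambient spaces; only their values on the stage-t
   sets are constrained, and costs (transitions) at stages t > T (t >= T) are
   irrelevant. One ambient noise space Xi loses no generality: it can be the
   disjoint union of the stage noise spaces. *)
Record soc (R : realType) (dS dA : nat) (Xi : ptopologicalType) := Soc {
  horizon : nat ;
  states : nat -> set 'rV[R]_dS ;
  controls : nat -> set 'rV[R]_dA ;
  noises : nat -> set Xi ;
  cost : nat -> 'rV[R]_dS -> 'rV[R]_dA -> R ;
  trans : nat -> 'rV[R]_dS -> 'rV[R]_dA -> Xi -> 'rV[R]_dS ;
  noise_law : nat -> probability (borel Xi) R
}.

Record soc_assumptions (R : realType) (dS dA : nat) (Xi : ptopologicalType)
    (M : soc R dS dA Xi) : Prop := SocAssumptions {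
  horizon_gt0 : (0 < horizon M)%N ;
  states_compact : forall t, (t <= horizon M)%N -> compact (states M t) ;
  controls_compact : forall t, (t <= horizon M)%N -> compact (controls M t) ;
  cost_itv : forall t s a, (t <= horizon M)%N ->
    states M t s -> controls M t a -> 0 <= cost M t s a <= 1 ;
  cost_continuous : forall t, (t <= horizon M)%N ->
    {within states M t `*` controls M t, continuous (uncurry (cost M t))} ;
  trans_states : forall t s a xi, (t < horizon M)%N ->
    states M t s -> controls M t a -> noises M t xi ->
    states M t.+1 (trans M t s a xi) ;
  trans_continuous : forall t, (t < horizon M)%N ->
    {within states M t `*` controls M t `*` noises M t,
      continuous (fun z : 'rV[R]_dS * 'rV[R]_dA * Xi =>
        trans M t z.1.1 z.1.2 z.2)} ;
  noises_measurable : forall t, (t < horizon M)%N ->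
    measurable (noises M t : set (borel Xi)) ;
  noise_law_supp : forall t, (t < horizon M)%N ->
    noise_law M t (noises M t) = 1%E
}.

Section policies.
Context (R : realType) (dS dA : nat) (Xi : ptopologicalType).
Variable M : soc R dS dA Xi.
Let T := horizon M.

(* [pi t h] is the law of A_t given the history h = (xi_0, ..., xi_(t-1)). *)
Definition policy : Type :=
  forall t, R.-pker t.-tuple (borel Xi) ~> borel 'rV[R]_dA.

Definition feasible_history t (h : t.-tuple Xi) : Prop :=
  forall i : 'I_t, noises M i (tnth h i).

Definition admissible : set policy := [set pi : policy |
  forall t, (t <= T)%N -> forall h : t.-tuple Xi, feasible_history h ->
    pi t h (controls M t) = 1%E].

Definition action_kernel (pi : policy) t :
    R.-pker t.-tuple (borel 'rV[R]_dA * borel Xi) ~> borel 'rV[R]_dA :=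
  kpullback (pi t) (@measurable_snd_tup _ _ _ _ t).

(* The law of (A_0, xi_0), ..., (A_(t-1), xi_(t-1)): given the past, A_t has
   law [pi t] at the noise history, and xi_t is independent of the past and
   of A_t. *)
Fixpoint prefix_law (pi : policy) (t : nat) :
    probability (t.-tuple (borel 'rV[R]_dA * borel Xi)) R :=
  match t with
  | 0 => \d_[tuple]
  | t'.+1 => distribution
      (semidirect (prefix_law pi t') (action_kernel pi t')
         \x noise_law M t')%E
      (@rcons_pair _ _ _ _ t')
  end.

Definition trajectory : Type :=
  (T.-tuple (borel 'rV[R]_dA * borel Xi) * borel 'rV[R]_dA)%type.

(* The law of ((A_0, xi_0), ..., (A_(T-1), xi_(T-1))), A_T. *)
Definition trajectory_law (pi : policy) : probability trajectory R :=
  semidirect (prefix_law pi T) (action_kernel pi T).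

Definition action_at (w : trajectory) (t : nat) : 'rV[R]_dA :=
  nth 0 (rcons (unzip1 w.1) w.2) t.

Definition noise_at (w : trajectory) (t : nat) : Xi :=
  nth point (unzip2 w.1) t.

Fixpoint state_at (s : 'rV[R]_dS) (w : trajectory) (t : nat) : 'rV[R]_dS :=
  match t with
  | 0 => s
  | t'.+1 => trans M t' (state_at s w t') (action_at w t') (noise_at w t')
  end.

Definition total_cost (s : 'rV[R]_dS) (w : trajectory) : R :=
  \sum_(t < T.+1) cost M t (state_at s w t) (action_at w t).

Definition feasible_trajectory : set trajectory := [set w : trajectory |
  (forall t, (t <= T)%N -> controls M t (action_at w t)) /\
  (forall t, (t < T)%N -> noises M t (noise_at w t))].

(* V_0^(pi, theta)(s) with phi = f_theta. Off the feasible trajectories, which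
   an admissible policy leaves with probability 0, cost and trans are
   unconstrained and possibly not measurable; hence the domain. *)
Definition value (phi : R -> R) (pi : policy) (s : 'rV[R]_dS) : R :=
  \int[trajectory_law pi]_(w in feasible_trajectory) phi (total_cost s w).

(* Minima over sets of values are taken as [inf], which presupposes nothing
   about attainment and is the minimum whenever one exists. *)
Definition risk (dTheta : nat) (Theta : set 'rV[R]_dTheta)
    (f : 'rV[R]_dTheta -> R -> R) (pi : policy) (s : 'rV[R]_dS) : R :=
  inf [set value (f theta) pi s | theta in Theta].

Definition optimal_value (phi : R -> R) (s : 'rV[R]_dS) : R :=
  inf [set value phi pi s | pi in admissible].

Definition aug_state : Type := (borel 'rV[R]_dS * R)%type.

Definition aug_states (t : nat) : set aug_state :=
  states M t `*` `[0, t%:R].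

Definition aug_cost (phi : R -> R) t (y : aug_state) (a : 'rV[R]_dA) : R :=
  phi (y.2 + cost M t y.1 a) - phi y.2.

Definition aug_trans t (y : aug_state) (a : 'rV[R]_dA) (xi : Xi) : aug_state :=
  (trans M t y.1 a xi, y.2 + cost M t y.1 a).

(* The expression minimized over a at stage t, where W is the value function
   of stage t + 1. *)
Definition bellman_obj (phi : R -> R) t (W : aug_state -> R) (y : aug_state)
    (a : 'rV[R]_dA) : R :=
  aug_cost phi t y a +
  (if (t < T)%N
   then \int[noise_law M t]_(xi in noises M t) W (aug_trans t y a xi)
   else 0).

(* The value function with n stages to go after the current one. *)
Fixpoint dp_to_go (phi : R -> R) (n : nat) : aug_state -> R :=
  let W := if n is n'.+1 then dp_to_go phi n' else cst 0 in
  fun y => inf [set bellman_obj phi (T - n) W y a | a in controls M (T - n)].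

Definition dp_value (phi : R -> R) (t : nat) : aug_state -> R :=
  dp_to_go phi (T - t).

Definition minimizing_selector (phi : R -> R)
    (g : nat -> aug_state -> borel 'rV[R]_dA) : Prop :=
  forall t, (t <= T)%N ->
    measurable_fun (aug_states t) (g t) /\
    forall y, aug_states t y -> controls M t (g t y) /\
      bellman_obj phi t (dp_value phi t.+1) y (g t y) = dp_value phi t y.

Fixpoint closed_loop (g : nat -> aug_state -> borel 'rV[R]_dA)
    (s : 'rV[R]_dS) (h : seq Xi) (t : nat) : aug_state :=
  match t with
  | 0 => (s, 0)
  | t'.+1 => let y := closed_loop g s h t' in
             aug_trans t' y (g t' y) (nth point h t')
  end.

(* pi is the policy in Pi(M) obtained by playing the feedback rule g from s. *)
Definition implements (pi : policy)
    (g : nat -> aug_state -> borel 'rV[R]_dA) (s : 'rV[R]_dS) : Prop :=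
  forall t, (t <= T)%N -> forall h : t.-tuple Xi, feasible_history h ->
  forall U : set (borel 'rV[R]_dA), measurable U ->
    pi t h U = \d_(g t (closed_loop g s h t)) U.

End policies.

(* Main.v *)
(* For any policy concentrated on a set [sel t y] of actions at each augmented
   state [y], the sequence [K + e (V_t(Y_t) + phi(X_t))], integrated over the
   trajectories that follow [sel], is nondecreasing in [t] as soon as
   [e V_t(y) <= e (Bellman objective at a)] for [a] in [sel t y]; the constant [K]
   makes everything nonnegative, so that Tonelli applies. For [e = 1] and all
   controls this gives [V_0(s, 0) + phi 0 <= value]; for [e = -1] and the
   singletons selected by [g] it gives the converse. Only measurability of the
   [V_t] is needed: it is inherited from the measurable selector, the cost and
   transition maps being jointly measurable as Caratheodory functions (the noise
   space need not be second countable).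
   Hence [V_0(s, 0) + f theta_star 0] is the optimal value at [theta_star], which
   by optimality of [theta_star] bounds every [value (f theta) pi] from below,
   and is attained at [theta_star] by the policy implementing [g]. *)

From HB Require Import structures.
From mathcomp Require Import finmap ring lra.
Require Import Defs.

Set Implicit Arguments.
Unset Strict Implicit.
Unset Printing Implicit Defensive.

Import Order.TTheory GRing.Theory Num.Theory.

(** * Measurability *)

Section borel_measurability.

Lemma measurable_borel_open (X : ptopologicalType) (U : set X) :
  open U -> measurable (U : set (borel X)).
Proof. by move=> oU; exact: sub_sigma_algebra. Qed.

Lemma measurable_borel_closed (X : ptopologicalType) (C : set X) :
  closed C -> measurable (C : set (borel X)).
Proof.
move=> cC; rewrite -[C]setCK; apply: measurableC.
exact: measurable_borel_open (closed_openC cC).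
Qed.

Lemma measurable_fun_borel d (Y : measurableType d) (Z : ptopologicalType)
    (E : set Y) (h : Y -> borel Z) :
  (forall U : set Z, open U -> measurable (E `&` h @^-1` U)) ->
  measurable_fun E h.
Proof. by move=> mh; apply: measurability => // _ [U oU <-]; exact: mh. Qed.

Lemma measurable_fun_real (R : realType) d (Y : measurableType d)
    (E : set Y) (h : Y -> R) :
  (forall U : set R, open U -> measurable (E `&` h @^-1` U)) ->
  measurable_fun E h.
Proof.
move=> mh; apply: (measurability _ (RGenOpens.measurableE R)) => _ [_ [a [b ->]] <-].
by apply: mh; exact: interval_open.
Qed.

Lemma within_continuous_open_preimage (X : ptopologicalType)
    (Z : topologicalType) (E : set X) (h : X -> Z) (U : set Z) :
  measurable (E : set (borel X)) -> {within E, continuous h} -> open U ->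
  measurable (E `&` h @^-1` U : set (borel X)).
Proof.
move=> mE /continuousP ch oU; have /open_subspaceP [V oV VE] := ch _ oU.
by rewrite setIC -VE setIC; apply: measurableI => //; exact: measurable_borel_open.
Qed.

End borel_measurability.

(** * Joint measurability of Caratheodory maps on a compact set *)

Section caratheodory.
Context (R : realType) (X : normedModType R) d (Y : measurableType d)
  (Z : pseudoMetricType R).

(** Compactness extracts a finite net inside [D] at each scale [1 / (n + 1)]. The nets supply the
    countably many points at which a Caratheodory map is sampled. *)
Lemma compact_dense_nets (D : set X) : compact D ->
  exists F : nat -> {fset X}, (forall n c, c \in F n -> D c) /\
    forall e : R, 0 < e -> exists n, forall x, D x ->
      exists2 c, c \in F n & ball x e c.
Proof.
move=> cD.
have npos n : (0 : R) < n.+1%:R^-1 by [].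
have fin n : finite_subset_cover D (fun z : X => (ball z n.+1%:R^-1)^°) D.
  move: cD; rewrite compact_cover; apply.
    by move=> z _; exact: open_interior.
  move=> x Dx; exists x => //; rewrite /interior.
  exact: (nbhsx_ballx x (PosNum (npos n))%:num).
have /choice [F HF] : forall n, exists G : {fset X}, (forall c, c \in G -> D c) /\
    D `<=` cover [set` G] (fun z => (ball z n.+1%:R^-1)^°).
  move=> n; have [G GD DG] := fin n; exists G; split => // c /GD.
  exact: set_mem.
exists F; split => [n c|e e0]; first by case: (HF n) => + _; exact.
have [N] := @ltr_add_invr R 0 e e0; rewrite add0r => Ne; exists N => x Dx.
have [_ /(_ x Dx) [c /= cF cx]] := HF N; exists c => //.
by apply/ball_sym/(le_ball (ltW Ne)); exact: interior_subset.
Qed.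

(* [h x y] lies in [U] iff some shrinking of [U] contains [h c y] for points [c]
   of the net arbitrarily close to [x]. *)
Lemma caratheodory_open_preimage (D : set X) (E : set Y) (h : X -> Y -> Z)
    (U : set Z) :
  compact D -> measurable (D : set (borel X)) -> measurable E ->
  (forall y, E y -> {within D, continuous (h ^~ y)}) ->
  (forall x (V : set Z), D x -> open V -> measurable (E `&` h x @^-1` V)) ->
  open U ->
  measurable ((D `*` E) `&` [set z | U (h z.1 z.2)] : set (borel X * Y)).
Proof.
move=> cD mD mE ch mh oU.
have [F [FD Fdense]] := compact_dense_nets cD.
pose r n : R := n.+1%:R^-1.
have r0 n : 0 < r n by rewrite invr_gt0.
(* [V n] is the interior, written as the complement of a closure, of the set of points whose ball of
   radius [r n] lies in [U]. *)
pose V n : set Z := ~` closure (~` [set z | ball z (r n) `<=` U]).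
have oV n : open (V n) by apply/closed_openC/closed_closure.
have VU n z z' : V n z -> ball z (r n) z' -> U z'.
  move=> /= Vz; apply: contrapT => /not_implyP [zz' Uz']; apply: Vz.
  by apply: subset_closure => /= /(_ z' zz').
have UV z : U z -> exists n e, 0 < e /\ ball z e `<=` V n.
  move=> Uz; have [e /= e0 zU] : nbhs_ball z U by exact/nbhs_ballP/open_nbhs_nbhs.
  (* The path [z], [y], [w], [w'] has three hops of at most [e / 4], hence stays within [e] of
     [z]. *)
  have e4 : 0 < e / 4 by rewrite divr_gt0.
  have [N] := @ltr_add_invr R 0 _ e4; rewrite add0r => /ltW Ne.
  exists N, (e / 4); split => // y zy /= /(_ (ball y (e / 4))) [].
    by apply: (nbhsx_ballx y (PosNum e4)%:num).
  move=> w /= [+ yw]; apply => w' ww'; apply: zU.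
  rewrite (_ : e = e / 4 + e / 4 + (e / 4 + e / 4)); last by lra.
  apply: le_ball (_ : ball z (e / 4 + e / 4 + e / 4) w'); first by lra.
  apply: ball_triangle (le_ball Ne ww').
  exact: ball_triangle zy yw.
have near_ball x y e : D x -> E y -> 0 < e -> exists2 b, 0 < b &
    forall c, D c -> ball x b c -> ball (h x y) e (h c y).
  move=> Dx Ey e0; have /subspace_continuousP/(_ x Dx) hx := ch y Ey.
  have : nbhs (h x y) (ball (h x y) e) by apply: (nbhsx_ballx _ (PosNum e0)%:num).
  move=> /hx; rewrite /= nbhs_filterE /within/= => /nbhs_ballP [b /= b0 bP].
  by exists b => // c Dc /bP; exact.
(* [n] is the margin of the value inside [U], [r k] the distance at which [x] is sampled.
   Conversely, once [r k] is below the continuity radius of [h] for [r n], the value at [x] is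
   within [r n] of a point of [V n], hence in [U]. *)
have -> : (D `*` E) `&` [set z | U (h z.1 z.2)] =
    \bigcup_n \bigcap_k \bigcup_m \bigcup_(c in [set` F m])
      ((D `&` (ball c (r k))^°) `*` (E `&` h c @^-1` V n)).
  apply/seteqP; split=> [[x y] [[/= Dx Ey] Uxy]|[x y] [n _ /= Hn]].
    have [n [e [e0 hV]]] := UV _ Uxy; exists n => // k _.
    have [b b0 bP] := near_ball x y e Dx Ey e0.
    (* Half of [r k] leaves room for a ball around [x] inside the ball of radius [r k] around [c];
       [b] controls the value. *)
    have rb0 : 0 < Num.min b (r k / 2) by rewrite lt_min b0 divr_gt0/=.
    have [m /(_ x Dx) [c cF xc]] := Fdense _ rb0; exists m => //; exists c => //=.
    have Dc := FD _ _ cF.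
    split; split => //; last first.
      by apply/hV/bP => //; apply: le_ball xc; rewrite ge_min lexx.
    have rk20 : 0 < r k / 2 by rewrite divr_gt0/=.
    apply/nbhs_ballP; exists (r k / 2) => // x' xx'.
    rewrite [r k]splitr; apply: ball_triangle xx'.
    by apply/ball_sym; apply: le_ball xc; rewrite ge_min lexx orbT.
  have [_ _ [? /= _ [[Dx _] [Ey _]]]] := Hn 0%N I; split => //.
  have [b b0 bP] := near_ball x y (r n) Dx Ey (r0 n).
  have [N] := @ltr_add_invr R 0 _ b0; rewrite add0r => /ltW Nb.
  have [m _ [c /= cF [[_ cx] [_ /VU]]]] := Hn N I; apply; apply: ball_sym.
  apply: bP; first exact: FD cF.
  by apply: ball_sym; apply: (le_ball Nb); exact: interior_subset.
apply: bigcup_measurable => n _; apply: bigcapT_measurable => k.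
apply: bigcup_measurable => m _; apply: fin_bigcup_measurable => // c /= cF.
apply: measurableX; last exact: mh (FD _ _ cF) (oV n).
apply: measurableI => //; apply: measurable_borel_open; exact: open_interior.
Qed.
End caratheodory.

(** * Integration *)

Section semidirect_tonelli.
Context d d' (X : measurableType d) (Y : measurableType d') (R : realType).
Variables (mu : probability X R) (k : R.-pker X ~> Y).
Local Open Scope ereal_scope.

(** The [unit] factor is there because [kcomp] takes its second kernel on the product of the source
    and the middle space; the source is a point since [mu] is a plain probability. *)
Definition kernel_graph (z : unit * X) : {measure set (X * Y) -> \bar R}.
Proof.
by refine (pushforward (k z.2) (pair z.2)); exact: pair1_measurable.
Defined.

Let measurable_kernel_graph U : measurable U ->
  measurable_fun setT (kernel_graph ^~ U).
Proof.
move=> mU.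
rewrite (_ : kernel_graph ^~ U = (fun x => k x (xsection U x)) \o snd); last first.
  apply/funext => -[u x]; rewrite /kernel_graph/= /pushforward.
  by rewrite xsectionE.
apply: measurableT_comp.
  by apply: measurable_fun_xsection_finite_kernel; exact: mem_set.
exact: measurable_snd.
Qed.

HB.instance Definition _ :=
  isKernel.Build _ _ _ _ _ kernel_graph measurable_kernel_graph.

Let kernel_graph_prob z : kernel_graph z setT = 1.
Proof. by rewrite /kernel_graph/= /pushforward preimage_setT prob_kernel. Qed.

HB.instance Definition _ :=
  Kernel_isProbability.Build _ _ _ _ _ kernel_graph kernel_graph_prob.

Definition kernel_start (u : unit) : {measure set X -> \bar R} := mu.

Let measurable_kernel_start U : measurable U ->
  measurable_fun setT (kernel_start ^~ U).
Proof. by move=> mU; exact: measurable_cst. Qed.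

HB.instance Definition _ :=
  isKernel.Build _ _ _ _ _ kernel_start measurable_kernel_start.

Let kernel_start_prob u : kernel_start u setT = 1.
Proof. exact: probability_setT. Qed.

HB.instance Definition _ :=
  Kernel_isProbability.Build _ _ _ _ _ kernel_start kernel_start_prob.

(* The semidirect product is the composition of [mu] with the kernel sending
   [x] to the law of [(x, y)], [y ~ k x]. *)
Lemma ge0_integral_semidirect (h : X * Y -> \bar R) :
  measurable_fun setT h -> (forall z, 0 <= h z) ->
  \int[semidirect mu k]_z h z = \int[mu]_x \int[k x]_y h (x, y).
Proof.
move=> mh h0.
rewrite (eq_measure_integral (kcomp kernel_start kernel_graph tt)); last first.
  move=> U mU _; apply: eq_integral => x _.
  rewrite /kernel_graph/= /pushforward.
  by rewrite xsectionE.
rewrite integral_kcomp//; apply: eq_integral => x _.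
rewrite ge0_integral_pushforward//; exact: pair1_measurable.
Qed.

End semidirect_tonelli.

(** Extending both maps by a default value off [D] reduces the claim to total maps. Measurability of
    [D] is supplied by the definition of [measurable_fun]. *)
Lemma measurable_fun_pair_dom d d1 d2 (T : measurableType d)
    (T1 : measurableType d1) (T2 : measurableType d2) (D : set T)
    (f : T -> T1) (g : T -> T2) :
  measurable_fun D f -> measurable_fun D g ->
  measurable_fun D (fun x => (f x, g x)).
Proof.
move=> + + mD => /(_ mD) mf /(_ mD) mg.
suff : measurable_fun D (fun x => (f x, g x)) by exact.
apply: (eq_measurable_fun (fun x => ((f \_ D) x, (g \_ D) x))).
  by move=> x xD; rewrite !patchE xD.
apply: measurable_funTS; apply: measurable_fun_pair;
  by apply/(measurable_restrictT _ mD) => ?.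
Qed.

Lemma measurable_nth d (X : measurableType d) n i : (i < n)%N ->
  measurable_fun setT (fun w : n.-tuple X => nth point w i).
Proof.
move=> lt_in; rewrite (_ : (fun _ => _) = (@tnth n X)^~ (Ordinal lt_in)).
  exact: measurable_tnth.
by apply/funext => w; rewrite (tnth_nth point).
Qed.

(* No integrability is assumed: [Rintegral] sends infinite integrals to [0]. *)
Lemma measurable_fun_Rintegral d d' (X : measurableType d)
    (Y : measurableType d') (R : realType) (mu : probability Y R)
    (D : set X) (E : set Y) (h : X * Y -> R) :
  measurable D -> measurable E -> measurable_fun (D `*` E) h ->
  measurable_fun D (fun x => \int[mu]_(y in E) h (x, y)).
Proof.
move=> mD mE mh.
(* The integrand is extended by zero to the whole product, where Tonelli gives measurability of the
   integrals of its positive and negative parts. *)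
pose h' := (EFin \o h) \_ (D `*` E).
have mh' : measurable_fun setT h'.
  apply/(measurable_restrictT _ (measurableX mD mE)); exact/measurable_EFinP.
pose F := fun x => fine (\int[mu]_y h'^\+ (x, y) - \int[mu]_y h'^\- (x, y)).
apply: (eq_measurable_fun F).
  move=> x xD; rewrite /F /Rintegral integralE; congr fine.
  rewrite [in RHS]integral_mkcond [X in _ = (_ - X)%E]integral_mkcond.
  congr (_ - _)%E; apply: eq_integral => y _.
    rewrite funeposE /h' !patchE in_setX xD /=.
    by case: ifPn => yE; [rewrite funeposE|rewrite maxxx].
  rewrite funenegE /h' !patchE in_setX xD /=.
  by case: ifPn => yE; [rewrite funenegE|rewrite oppe0 maxxx].
apply: measurable_funTS; apply: measurableT_comp.
  exact: fine_measurable.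
apply: emeasurable_funB.
  have := measurable_fun_fubini_tonelli_F (m2 := mu) h'^\+%E.
  by apply; [exact: measurable_funepos|exact: funepos_ge0].
have := measurable_fun_fubini_tonelli_F (m2 := mu) h'^\-%E.
by apply; [exact: measurable_funeneg|exact: funeneg_ge0].
Qed.

(** * Measurability of the model *)

(** Applied to maps [g] that freeze some coordinates: continuity on a product of stage sets then
    yields continuity in each variable. *)
Lemma within_continuous_precomp (X Y Z : topologicalType) (E : set X)
    (D : set Y) (g : X -> Y) (f : Y -> Z) :
  continuous g -> (forall x, E x -> D (g x)) -> {within D, continuous f} ->
  {within E, continuous (f \o g)}.
Proof.
move=> cg ED /subspace_continuousP cf; apply/subspace_continuousP => x Ex.
move=> W /(cf _ (ED _ Ex)); rewrite !nbhs_filterE /within/= => /cg gW.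
exact: filterS (fun x' H Ex' => H (ED _ Ex')) gW.
Qed.

Lemma continuous_pair (X Y Z : topologicalType) (f : X -> Y) (g : X -> Z) :
  continuous f -> continuous g -> continuous (fun x => (f x, g x)).
Proof. by move=> cf cg x; apply: cvg_pair; [exact: cf|exact: cg]. Qed.

Lemma compact_measurable_borel (R : realType) n (C : set 'rV[R]_n) :
  compact C -> measurable (C : set (borel 'rV[R]_n)).
Proof.
move=> cC; apply: measurable_borel_closed; apply: compact_closed cC.
exact: (@norm_hausdorff R 'rV[R]_n).
Qed.

Lemma measurable_coord (R : realType) n (i : 'I_n) :
  measurable_fun setT (fun x : borel 'rV[R]_n => (x : 'rV[R]_n) ord0 i).
Proof.
apply: measurable_fun_real => U oU; rewrite setTI.
apply: measurable_borel_open; apply: open_comp oU => x _.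
exact: coord_continuous.
Qed.

Section model_measurability.
Context (R : realType) (dS dA : nat) (Xi : ptopologicalType).
Variables (M : soc R dS dA Xi) (HM : soc_assumptions M).

Lemma measurable_states t : (t <= horizon M)%N ->
  measurable (states M t : set (borel 'rV[R]_dS)).
Proof. by move=> tT; exact: compact_measurable_borel (states_compact HM tT). Qed.

Lemma measurable_controls t : (t <= horizon M)%N ->
  measurable (controls M t : set (borel 'rV[R]_dA)).
Proof. by move=> tT; exact: compact_measurable_borel (controls_compact HM tT). Qed.

(** Continuity on the product speaks of the product topology, while measurability is wanted for the
    product of the Borel sigma-algebras. The Caratheodory argument, with the state as the compact
    variable, bridges the two. *)
Lemma measurable_cost t : (t <= horizon M)%N ->
  measurable_fun (states M t `*` controls M t :
      set (borel 'rV[R]_dS * borel 'rV[R]_dA))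
    (fun z => cost M t z.1 z.2).
Proof.
move=> tT; have mS := measurable_states tT; have mA := measurable_controls tT.
have cc := cost_continuous HM tT.
apply: measurable_fun_real => U oU.
have := @caratheodory_open_preimage R 'rV[R]_dS _ (borel 'rV[R]_dA) R
  (states M t) (controls M t) (cost M t) U.
apply => //.
- exact: (states_compact HM tT).
- move=> a Aa; suff : {within states M t, continuous
      (uncurry (cost M t) \o (fun x : 'rV[R]_dS => (x, a : 'rV[R]_dA)))} by [].
  apply: within_continuous_precomp cc => [|//].
  by apply: continuous_pair => [z|]; [exact: cvg_id|exact: cst_continuous].
- move=> x V Sx oV; apply: within_continuous_open_preimage => //.
  suff : {within controls M t, continuous
      (uncurry (cost M t) \o pair x)} by [].
  apply: within_continuous_precomp cc => [|//].
  by apply: continuous_pair => [|z]; [exact: cst_continuous|exact: cvg_id].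
Qed.

(** Two Caratheodory arguments: at a fixed state, with the action as the compact variable and the
    noise as parameter; then with the state as the compact variable and the pair of action and noise
    as parameter. *)
Lemma measurable_trans t : (t < horizon M)%N ->
  measurable_fun (states M t `*` controls M t `*` noises M t :
      set (borel 'rV[R]_dS * borel 'rV[R]_dA * borel Xi))
    (fun z => trans M t z.1.1 z.1.2 z.2 : borel 'rV[R]_dS).
Proof.
move=> lt_tT; have tT := ltnW lt_tT.
have mS := measurable_states tT; have mA := measurable_controls tT.
have mN := noises_measurable HM lt_tT.
have tc := trans_continuous HM lt_tT.
have tV x (U : set 'rV[R]_dS) : states M t x -> open U ->
    measurable ((controls M t `*` noises M t) `&`
      [set z | U (trans M t x z.1 z.2)] : set (borel 'rV[R]_dA * borel Xi)).
  move=> Sx oU; have := @caratheodory_open_preimage R 'rV[R]_dA _ (borel Xi)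
    'rV[R]_dS (controls M t) (noises M t) (trans M t x) U.
  apply => //.
  - exact: (controls_compact HM tT).
  - move=> xi Nxi; suff : {within controls M t, continuous
        ((fun z : 'rV[R]_dS * 'rV[R]_dA * Xi => trans M t z.1.1 z.1.2 z.2) \o
         (fun a : 'rV[R]_dA => (x, a, xi : Xi)))} by [].
    apply: within_continuous_precomp tc => [|//].
    apply: continuous_pair; last exact: cst_continuous.
    by apply: continuous_pair => [|z]; [exact: cst_continuous|exact: cvg_id].
  - move=> a V Aa oV; apply: within_continuous_open_preimage => //.
    suff : {within noises M t, continuous
        ((fun z : 'rV[R]_dS * 'rV[R]_dA * Xi => trans M t z.1.1 z.1.2 z.2) \o
         (fun xi : Xi => (x, a, xi)))} by [].
    apply: within_continuous_precomp tc => [|//].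
    by apply: continuous_pair => [|z]; [exact: cst_continuous|exact: cvg_id].
apply: measurable_fun_borel => U oU.
(* The triple is regrouped so that the state stands alone as the compact factor. *)
pose assoc (z : borel 'rV[R]_dS * borel 'rV[R]_dA * borel Xi) :=
  (z.1.1, (z.1.2, z.2)).
have massoc : measurable_fun setT assoc.
  apply: measurable_fun_pair.
    by apply: (measurableT_comp measurable_fst); exact: measurable_fst.
  apply: measurable_fun_pair; last exact: measurable_snd.
  by apply: (measurableT_comp measurable_snd); exact: measurable_fst.
have := @caratheodory_open_preimage R 'rV[R]_dS _
  (borel 'rV[R]_dA * borel Xi)%type 'rV[R]_dS (states M t)
  (controls M t `*` noises M t) (fun s z => trans M t s z.1 z.2) U.
move=> /(_ (states_compact HM tT) mS (measurableX mA mN)) mP.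
have /(massoc measurableT) : measurable (
    (states M t `*` (controls M t `*` noises M t)) `&`
      [set z | U (trans M t z.1 z.2.1 z.2.2)] :
    set (borel 'rV[R]_dS * (borel 'rV[R]_dA * borel Xi))).
  apply: mP => //.
  move=> [a xi] [/= Aa Nxi]; suff : {within states M t, continuous
      ((fun z : 'rV[R]_dS * 'rV[R]_dA * Xi => trans M t z.1.1 z.1.2 z.2) \o
       (fun x : 'rV[R]_dS => (x, a : 'rV[R]_dA, xi : Xi)))} by [].
  apply: within_continuous_precomp tc => [|//].
  apply: continuous_pair; last exact: cst_continuous.
  by apply: continuous_pair => [x|]; [exact: cvg_id|exact: cst_continuous].
rewrite setTI; congr measurable; apply/seteqP.
by split=> -[[x a] xi]/=; rewrite /assoc/= => -[]; tauto.
Qed.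

End model_measurability.

(** * Integrals of bounded functions under a probability *)

Section bounded_integrals.
Context d (X : measurableType d) (R : realType) (mu : probability X R).
Variables (E : set X) (h : X -> R) (b : R).
Hypotheses (mE : measurable E) (mh : measurable_fun E h).
Hypothesis hb : forall x, E x -> `|h x| <= b.

Lemma bounded_integrable : mu.-integrable E (EFin \o h).
Proof.
apply: measurable_bounded_integrable => //.
  by rewrite (le_lt_trans (probability_le1 mu mE))// ltry.
exists b; split; first exact: num_real.
by move=> c bc x Ex /=; rewrite (le_trans (hb Ex))// ltW.
Qed.

Lemma bounded_normr_Rintegral : 0 <= b -> `|\int[mu]_(x in E) h x| <= b.
Proof.
move=> b0; apply: le_trans (le_normr_Rintegral mE bounded_integrable) _.
apply: (@le_trans _ _ (\int[mu]_(x in E) b)).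
  apply: le_Rintegral => //.
  - by have := integrable_norm bounded_integrable.
  - apply: measurable_bounded_integrable => //.
      by rewrite (le_lt_trans (probability_le1 mu mE))// ltry.
    exists b; split; first exact: num_real.
    by move=> c bc x Ex /=; rewrite ger0_norm// ltW.
rewrite Rintegral_cst// ler_piMr// -lee_fin fineK ?probability_le1//.
exact: fin_num_measure.
Qed.

End bounded_integrals.

(** * The augmented state space and the measurability of its dynamics *)

Section augmented_model.
Context (R : realType) (dS dA : nat) (Xi : ptopologicalType).
Variables (M : soc R dS dA Xi) (HM : soc_assumptions M).
Local Notation T := (horizon M).

Lemma measurable_aug_states t : (t <= T)%N -> measurable (aug_states M t).
Proof.
move=> tT; apply: measurableX; first exact: measurable_states.
exact: measurable_itv.
Qed.

(** Each stage adds at most 1, so accumulated costs stay in the interval up to [T + 1] on which the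
    utility is controlled. *)
Lemma aug_cost_itv t (y : aug_state R dS) a : (t <= T)%N ->
  aug_states M t y -> controls M t a ->
  0 <= y.2 + cost M t y.1 a <= t.+1%:R.
Proof.
move=> tT [/= Sy]; rewrite in_itv/= => /andP[y0 yt] Aa.
have /andP[c0 c1] := cost_itv HM tT Sy Aa.
by rewrite addr_ge0//= -natr1 lerD.
Qed.

Lemma aug_trans_states t (y : aug_state R dS) a xi : (t < T)%N ->
  aug_states M t y -> controls M t a -> noises M t xi ->
  aug_states M t.+1 (aug_trans M t y a xi).
Proof.
move=> tT Sy Aa Nxi; split => /=; last first.
  by rewrite in_itv/=; exact: aug_cost_itv (ltnW tT) Sy Aa.
by case: Sy => Sy _; exact: (trans_states HM).
Qed.

Section compositions.
Context d (Z : measurableType d) (D : set Z) (t : nat).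
Variables (y : Z -> aug_state R dS) (a : Z -> borel 'rV[R]_dA).
Hypotheses (my : measurable_fun D y) (ma : measurable_fun D a).
Hypothesis yS : forall z, D z -> aug_states M t (y z).
Hypothesis aC : forall z, D z -> controls M t (a z).

Lemma measurable_aug_cost_comp : (t <= T)%N ->
  measurable_fun D (fun z => (y z).2 + cost M t (y z).1 (a z)).
Proof.
move=> tT; apply: measurable_funD.
  by apply: (measurableT_comp measurable_snd).
have mc := measurable_cost HM tT.
have mya : measurable_fun D (fun z => ((y z).1, a z)).
  apply: measurable_fun_pair_dom => //.
  by apply: (measurableT_comp measurable_fst).
apply: (measurable_comp _ _ mc mya).
  by apply: measurableX; [exact: measurable_states|exact: measurable_controls].
by move=> _ [z Dz <-]; split; [case: (yS Dz)|exact: aC].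
Qed.

Lemma measurable_aug_trans_comp (xi : Z -> borel Xi) : (t < T)%N ->
  measurable_fun D xi -> (forall z, D z -> noises M t (xi z)) ->
  measurable_fun D (fun z => aug_trans M t (y z) (a z) (xi z) : aug_state R dS).
Proof.
move=> tT mxi xiN; apply: measurable_fun_pair_dom; last first.
  exact: measurable_aug_cost_comp (ltnW tT).
have mtr := measurable_trans HM tT.
have mya : measurable_fun D (fun z => ((y z).1, a z, xi z)).
  apply: measurable_fun_pair_dom => //; apply: measurable_fun_pair_dom => //.
  by apply: (measurableT_comp measurable_fst).
apply: (measurable_comp _ _ mtr mya).
  apply: measurableX; last exact: (noises_measurable HM).
  by apply: measurableX; [apply: measurable_states => //|
    apply: measurable_controls => //]; exact: ltnW.
move=> _ [z Dz <-]; split; last exact: xiN.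
by split; [case: (yS Dz)|exact: aC].
Qed.

End compositions.
End augmented_model.

(** * Dynamic programming *)

Lemma measurable_lipschitz (R : realType) (I : interval R) (phi : R -> R)
    (L : R) : 0 <= L ->
  (forall z z', z \in I -> z' \in I -> `|phi z - phi z'| <= L * `|z - z'|) ->
  measurable_fun [set` I] phi.
Proof.
move=> L0 Hphi; apply: subspace_continuous_measurable_fun => //.
apply/subspace_continuousP => x Ix; apply/cvgrPdist_le => e e0.
(* [L + 1] replaces [L] so that the division below is legitimate when [L = 0]. *)
have L1 : 0 < L + 1 by rewrite ltr_wpDl.
rewrite near_withinE; near=> x' => Ix'.
apply: le_trans (Hphi _ _ Ix Ix') _.
apply: (@le_trans _ _ ((L + 1) * `|x - x'|)).
  by rewrite ler_wpM2r// lerDl.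
rewrite mulrC -ler_pdivlMr//; apply: ltW; near: x'.
apply/nbhs_ballP; exists (e / (L + 1)) => /=; first by rewrite divr_gt0.
by move=> y; rewrite -ball_normE.
Unshelve. all: by end_near. Qed.

Section dynamic_programming.
Context (R : realType) (dS dA : nat) (Xi : ptopologicalType).
Variables (M : soc R dS dA Xi) (HM : soc_assumptions M).
Local Notation T := (horizon M).
Variables (phi : R -> R) (L : R).
Hypothesis Hphi : forall z z' : R, z \in `[0, T.+1%:R] ->
  z' \in `[0, T.+1%:R] -> `|phi z - phi z'| <= L * `|z - z'|.

(** The points 1 and 0 lie in the interval at distance 1, so [L] dominates an absolute value. *)
Lemma lipschitz_cst_ge0 : 0 <= L.
Proof.
have := Hphi (z := 1) (z' := 0); rewrite !in_itv/= lexx ler01 ler0n ler1n.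
by move=> /(_ isT isT); rewrite subr0 normr1 mulr1; exact: le_trans.
Qed.

Lemma phi_bounded z : z \in `[0, T.+1%:R] ->
  `|phi z| <= `|phi 0| + L * T.+1%:R.
Proof.
move=> zI; have := Hphi (z := z) (z' := 0) zI.
rewrite in_itv/= lexx ler0n subr0 => /(_ isT) zL.
rewrite -[phi z](subrK (phi 0)) addrC (le_trans (ler_normD _ _))// lerD2l.
rewrite (le_trans zL)// ler_wpM2l ?lipschitz_cst_ge0//.
by move: zI; rewrite in_itv/= => /andP[z0 zT]; rewrite ger0_norm.
Qed.

Lemma phi_itv_sub t (z : R) : (t <= T.+1)%N -> 0 <= z <= t%:R -> z \in `[0, T.+1%:R].
Proof.
move=> tT /andP[z0 zt]; rewrite in_itv/= z0 (le_trans zt)//.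
by rewrite ler_nat.
Qed.

Lemma measurable_phi_comp d (Z : measurableType d) (D : set Z) (h : Z -> R) :
  measurable_fun D h -> (forall z, D z -> h z \in `[0, T.+1%:R]) ->
  measurable_fun D (phi \o h).
Proof.
move=> mh hI; apply: measurable_comp mh.
- exact: (measurable_itv `[0, T.+1%:R]).
- by move=> _ [z Dz <-]; exact: hI.
- exact: measurable_lipschitz lipschitz_cst_ge0 Hphi.
Qed.

Lemma aug_cost_bounded t y a : (t <= T)%N -> aug_states M t y ->
  controls M t a -> `|aug_cost M phi t y a| <= L.
Proof.
move=> tT Sy Aa; rewrite /aug_cost.
have yI : y.2 \in `[0, T.+1%:R].
  by apply: (@phi_itv_sub t); [exact: leqW|case: Sy].
have ycI : y.2 + cost M t y.1 a \in `[0, T.+1%:R].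
  by apply: (@phi_itv_sub t.+1) => //; exact: aug_cost_itv Sy Aa.
apply: le_trans (Hphi ycI yI) _; rewrite addrAC subrr add0r.
have /andP[c0 c1] := cost_itv HM tT (proj1 Sy) Aa.
by rewrite ler_piMr ?lipschitz_cst_ge0// ger0_norm.
Qed.

Lemma dp_valueE t y : (t <= T)%N -> dp_value M phi t y =
  inf [set bellman_obj M phi t (dp_value M phi t.+1) y a | a in controls M t].
Proof.
move=> tT; rewrite /dp_value; have tE : (T - (T - t))%N = t by rewrite subKn.
case nE : (T - t)%N => [|n] in tE *; rewrite [LHS]/= tE.
  (* At [t = T], truncated subtraction makes [dp_value] at [T + 1] coincide with [dp_value] at [T]
     instead of 0; both sides agree because [bellman_obj] reads its value function only when
     [t < T]. *)
  congr inf; congr image; apply/funext => a; rewrite /bellman_obj.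
  by rewrite ltnNge -subn_eq0 nE.
by rewrite subnS nE.
Qed.

Section bellman.
Variables (t : nat) (W : aug_state R dS -> R) (b : R).
Hypothesis tT : (t <= T)%N.
Hypothesis mW : (t < T)%N -> measurable_fun (aug_states M t.+1) W.
Hypothesis Wb : (t < T)%N -> forall y, aug_states M t.+1 y -> `|W y| <= b.
Hypothesis b0 : 0 <= b.

Lemma measurable_next y a : (t < T)%N -> aug_states M t y -> controls M t a ->
  measurable_fun (noises M t : set (borel Xi)) (fun xi => W (aug_trans M t y a xi)).
Proof.
move=> lt_tT Sy Aa.
have mtr : measurable_fun (noises M t : set (borel Xi))
    (fun xi => aug_trans M t y a xi : aug_state R dS).
  exact: (measurable_aug_trans_comp HM (y := fun=> y) (a := fun=> a)).
apply: (measurable_comp _ _ (mW lt_tT) mtr).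
  exact: measurable_aug_states.
by move=> _ [xi Nxi <-]; exact: aug_trans_states.
Qed.

(** The assumptions on [W] are conditional on [t < T], so that the last stage, where only the
    augmented cost remains, is covered too. *)
Lemma bellman_obj_bounded y a : aug_states M t y -> controls M t a ->
  `|bellman_obj M phi t W y a| <= L + b.
Proof.
move=> Sy Aa; rewrite /bellman_obj (le_trans (ler_normD _ _))// lerD//.
  exact: aug_cost_bounded.
case: ifPn => lt_tT; last by rewrite normr0.
apply: bounded_normr_Rintegral => //.
- exact: (noises_measurable HM).
- exact: measurable_next.
- by move=> xi Nxi; apply: Wb => //; exact: aug_trans_states.
Qed.

(** The expected continuation is a parameter integral, measurable in [z] because the integrand is
    jointly measurable in [z] and the noise. *)
Lemma measurable_bellman_obj_comp d (Z : measurableType d) (D : set Z)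
    (y : Z -> aug_state R dS) (a : Z -> borel 'rV[R]_dA) : measurable D ->
  measurable_fun D y -> measurable_fun D a ->
  (forall z, D z -> aug_states M t (y z)) ->
  (forall z, D z -> controls M t (a z)) ->
  measurable_fun D (fun z => bellman_obj M phi t W (y z) (a z)).
Proof.
move=> mD my ma yS aC; apply: measurable_funD.
  apply: measurable_funB; apply: measurable_phi_comp.
  - exact: (measurable_aug_cost_comp HM).
  - move=> z Dz; apply: (@phi_itv_sub t.+1) => //.
    by apply: aug_cost_itv => //; [exact: yS|exact: aC].
  - by apply: (measurableT_comp measurable_snd).
  - move=> z Dz; apply: (@phi_itv_sub t); first exact: leqW.
    by case: (yS z Dz).
have [lt_tT|_] := ltnP t T; last exact: measurable_cst.
have mN := noises_measurable HM lt_tT.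
apply: (@measurable_fun_Rintegral _ _ Z (borel Xi) R (noise_law M t) D
  (noises M t) (fun z => W (aug_trans M t (y z.1) (a z.1) z.2))) => //.
have m1 : measurable_fun (D `*` (noises M t : set (borel Xi))) fst.
  exact: measurable_funTS.
have mtr : measurable_fun (D `*` (noises M t : set (borel Xi)))
    (fun z => aug_trans M t (y z.1) (a z.1) z.2 : aug_state R dS).
  apply: (measurable_aug_trans_comp HM (y := y \o fst) (a := a \o fst)) => //.
  - by apply: (measurable_comp mD _ my m1) => _ [z [Dz _] <-].
  - by apply: (measurable_comp mD _ ma m1) => _ [z [Dz _] <-].
  - by move=> z [Dz _]; exact: yS.
  - by move=> z [Dz _]; exact: aC.
  - exact: measurable_funTS.
  - by move=> z [].
apply: (measurable_comp _ _ (mW lt_tT) mtr).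
  exact: measurable_aug_states.
by move=> _ [z [Dz Nz] <-]; apply: aug_trans_states => //; [exact: yS|exact: aC].
Qed.

End bellman.

Variable g : nat -> aug_state R dS -> borel 'rV[R]_dA.
Hypothesis Hg : minimizing_selector M phi g.

(** An infimum over uncountably many actions need not be measurable; here it equals the Bellman
    objective along the measurable selector. The induction runs backward in time, each remaining
    stage contributing at most [L] to the bound. *)
Lemma dp_value_measurable_bounded t : (t <= T)%N ->
  measurable_fun (aug_states M t) (dp_value M phi t) /\
  (forall y, aug_states M t y -> `|dp_value M phi t y| <= L *+ (T - t).+1).
Proof.
have [n] := ubnP (T - t)%N; elim: n t => // n IH t; rewrite ltnS => tn tT.
have step : (t < T)%N -> measurable_fun (aug_states M t.+1) (dp_value M phi t.+1) /\
  (forall y, aug_states M t.+1 y -> `|dp_value M phi t.+1 y| <= L *+ (T - t)).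
  move=> lt_tT; have tS : (T - t = (T - t.+1).+1)%N by rewrite -subSn// subSS.
  by rewrite tS; apply: IH => //; rewrite -tS.
have [mg gP] := Hg tT.
have L0 := lipschitz_cst_ge0.
split.
  apply: (eq_measurable_fun (fun y =>
    bellman_obj M phi t (dp_value M phi t.+1) y (g t y))).
    by move=> y /set_mem Sy; case: (gP y Sy).
  apply: measurable_bellman_obj_comp => //.
  - by move=> /step[].
  - exact: measurable_aug_states.
  - by move=> y Sy; case: (gP y Sy).
move=> y Sy; have [gC <-] := gP y Sy; rewrite mulrS.
apply: bellman_obj_bounded => //; last by rewrite mulrn_wge0.
- by move=> /step[].
- by move=> /step[].
Qed.

Lemma dp_value_le_bellman t y a : (t <= T)%N -> aug_states M t y ->
  controls M t a ->
  dp_value M phi t y <= bellman_obj M phi t (dp_value M phi t.+1) y a.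
Proof.
move=> tT Sy Aa; rewrite dp_valueE//; apply: ge_inf; last by exists a.
have next (lt_tT : (t < T)%N) := dp_value_measurable_bounded lt_tT.
(* A real [inf] is a lower bound only if the set is bounded below; the uniform bound on the Bellman
   objective ensures it. *)
exists (- (L + L *+ (T - t.+1).+1)) => _ [c Ac <-].
have : `|bellman_obj M phi t (dp_value M phi t.+1) y c| <= L + L *+ (T - t.+1).+1.
  apply: bellman_obj_bounded => //; last by rewrite mulrn_wge0// lipschitz_cst_ge0.
  - by move=> /next[].
  - by move=> /next[].
by rewrite ler_norml => /andP[].
Qed.

End dynamic_programming.

Section semidirect_bound.
Context d d' (X : measurableType d) (Y : measurableType d') (R : realType).
Variables (mu : probability X R) (k : R.-pker X ~> Y).
Local Open Scope ereal_scope.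

(** On [D], the section of [G] has mass 1 under [k x], so [u x] is its own integral over that
    section, where [v] dominates it. Enlarging the domain to everything only increases the integral
    of the nonnegative [v]. *)
Lemma le_integral_semidirect (D : set X) (G : set (X * Y)) (u : X -> \bar R)
    (v : X * Y -> \bar R) : measurable D -> measurable G ->
  measurable_fun D u -> (forall x, D x -> 0 <= u x) ->
  measurable_fun setT v -> (forall z, 0 <= v z) ->
  (forall x, D x -> k x (xsection G x) = 1) ->
  (forall x y, D x -> G (x, y) -> u x <= v (x, y)) ->
  \int[mu]_(x in D) u x <= \int[semidirect mu k]_z v z.
Proof.
move=> mD mG mu' u0 mv v0 kG uv.
rewrite ge0_integral_semidirect// integral_mkcond.
apply: ge0_le_integral => //.
- by move=> x _; rewrite patchE; case: ifPn => // /set_mem; exact: u0.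
- exact/(measurable_restrictT _ mD).
- exact: measurable_fun_integral_finite_kernel.
move=> x _; rewrite patchE; case: ifPn => [/set_mem Dx|_]; last first.
  by apply: integral_ge0 => y _.
have mGx : measurable (xsection G x) by exact: measurable_xsection.
have mvx : measurable_fun setT (fun y => v (x, y)) by exact: measurable_fun_pair2.
rewrite -[u x]mule1 -(kG x Dx) -integral_cst//.
apply: (@le_trans _ _ (\int[k x]_(y in xsection G x) v (x, y))).
  apply: ge0_le_integral => //.
  - by move=> y _; exact: u0.
  - exact: measurable_funTS.
  - by move=> y /xsectionP; exact: uv.
by apply: ge0_subset_integral => //.
Qed.

End semidirect_bound.

(** * Trajectories *)

Section trajectories.
Context (R : realType) (dS dA : nat) (Xi : ptopologicalType).
Variables (M : soc R dS dA Xi) (HM : soc_assumptions M).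
Local Notation T := (horizon M).
Local Notation event := (borel 'rV[R]_dA * borel Xi)%type.
Variable s : 'rV[R]_dS.

(** Defined on plain sequences of pairs of action and noise, so that a prefix and its extensions
    share one definition. *)
Fixpoint aug_at (w : seq event) (t : nat) : aug_state R dS :=
  match t with
  | 0 => (s, 0)
  | t'.+1 => aug_trans M t' (aug_at w t') (nth point w t').1 (nth point w t').2
  end.

(** The abstract [sel] covers both feasibility (all controls allowed) and obedience to a feedback
    rule (one action allowed). *)
Definition follows (sel : nat -> aug_state R dS -> set 'rV[R]_dA)
    (t : nat) (w : seq event) : Prop :=
  forall i, (i < t)%N ->
    sel i (aug_at w i) (nth point w i).1 /\ noises M i (nth point w i).2.

Lemma aug_at_rcons (w : seq event) z t : (t <= size w)%N ->
  aug_at (rcons w z) t = aug_at w t.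
Proof.
elim: t => //= t IH tw; rewrite IH; last exact: ltnW.
by rewrite nth_rcons tw.
Qed.

Section selection.
Variable sel : nat -> aug_state R dS -> set 'rV[R]_dA.

Lemma followsS t w : follows sel t.+1 w <->
  follows sel t w /\ sel t (aug_at w t) (nth point w t).1 /\
  noises M t (nth point w t).2.
Proof.
split=> [ft|[ft st] i]; first by split; [move=> i it; exact/ft/ltnW|exact: ft].
by rewrite ltnS leq_eqVlt => /predU1P[->//|]; exact: ft.
Qed.

Lemma follows_rcons (w : seq event) z :
  follows sel (size w).+1 (rcons w z) <->
  follows sel (size w) w /\ sel (size w) (aug_at w (size w)) z.1 /\
  noises M (size w) z.2.
Proof.
rewrite followsS aug_at_rcons// nth_rcons ltnn eqxx.
suff -> : follows sel (size w) (rcons w z) = follows sel (size w) w by [].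
by apply/propext; split=> fw i iw; have := fw i iw;
  rewrite aug_at_rcons ?(ltnW iw)// nth_rcons iw.
Qed.

Hypothesis sel_sub : forall t y, (t <= T)%N -> aug_states M t y ->
  sel t y `<=` controls M t.
Hypothesis s0 : states M 0 s.

Lemma follows_aug_states t w : (t <= T)%N -> follows sel t w ->
  aug_states M t (aug_at w t).
Proof.
elim: t => [_ _|t IH tT /followsS [ft [st nt]]] /=.
  by split => //=; rewrite in_itv/= lexx.
have St := IH (ltnW tT) ft.
by apply: aug_trans_states => //; apply: sel_sub st => //; exact: ltnW.
Qed.

Hypothesis msel : forall t, (t <= T)%N -> measurable
  ([set z | aug_states M t z.1 /\ sel t z.1 z.2] :
     set (aug_state R dS * borel 'rV[R]_dA)).

(** Both claims advance together: stage [t] of the prefix is tested by pulling back the graph of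
    [sel] along [aug_at], and the next [aug_at] is then measurable on the smaller set. A fixed
    length [n] keeps all stages on one space. *)
Lemma measurable_follows n t : (t <= n)%N -> (t <= T)%N ->
  measurable [set w : n.-tuple event | follows sel t w] /\
  measurable_fun [set w : n.-tuple event | follows sel t w]
    (fun w : n.-tuple event => aug_at w t).
Proof.
elim: t => [_ _|t IH tn tT].
  rewrite (_ : [set w : n.-tuple event | _] = setT); last exact/seteqP.
  by split => //; exact: measurable_cst.
have [mF mY] := IH (ltnW tn) (ltnW tT).
have mnth := @measurable_nth _ event n t tn.
have m1 : measurable_fun setT (fun w : n.-tuple event => (nth point w t).1).
  exact: measurableT_comp measurable_fst mnth.
have m2 : measurable_fun setT (fun w : n.-tuple event => (nth point w t).2).
  exact: measurableT_comp measurable_snd mnth.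
have mFS : measurable [set w : n.-tuple event | follows sel t.+1 w].
  rewrite (_ : mkset _ =
    ([set w : n.-tuple event | follows sel t w] `&`
      (fun w : n.-tuple event => (aug_at w t, (nth point w t).1)) @^-1`
      [set z | aug_states M t z.1 /\ sel t z.1 z.2]) `&`
    (setT `&` (fun w : n.-tuple event => (nth point w t).2) @^-1` noises M t)).
    apply: measurableI; last by apply: m2 => //; exact: (noises_measurable HM).
    have mp : measurable_fun [set w : n.-tuple event | follows sel t w]
        (fun w : n.-tuple event => (aug_at w t, (nth point w t).1)).
      by apply: measurable_fun_pair_dom => //; exact: measurable_funTS.
    exact: (mp mF _ (msel (ltnW tT))).
  apply/seteqP; split=> w /=.
    move=> /followsS[ft [st nt]]; split=> //; split=> //; split=> //.
    exact: follows_aug_states (ltnW tT) ft.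
  by move=> [[ft [_ st]] [_ nt]]; exact/followsS.
have sub : [set w : n.-tuple event | follows sel t.+1 w] `<=`
    [set w : n.-tuple event | follows sel t w].
  by move=> w /= /followsS[].
split => //=; apply: (measurable_aug_trans_comp HM) => //.
- exact: measurable_funS mF sub mY.
- exact: measurable_funTS.
- by move=> w /sub; exact: follows_aug_states (ltnW tT).
- move=> w /= fw; have /= ft := sub _ fw; move/followsS: fw => [_ [st _]].
  apply: sel_sub st; first exact: ltnW.
  exact: follows_aug_states (ltnW tT) ft.
- exact: measurable_funTS.
- by move=> w /= /followsS[_ []].
Qed.

End selection.
End trajectories.

(** * Verification *)

Section verification.
Context (R : realType) (dS dA : nat) (Xi : ptopologicalType).
Variables (M : soc R dS dA Xi) (HM : soc_assumptions M).
Local Notation T := (horizon M).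
Local Notation event := (borel 'rV[R]_dA * borel Xi)%type.
Variables (s : 'rV[R]_dS) (s0 : states M 0 s).

Definition any_control (t : nat) (_ : aug_state R dS) := controls M t.

Lemma measurable_any_control t : (t <= T)%N -> measurable
  ([set z | aug_states M t z.1 /\ any_control t z.1 z.2] :
     set (aug_state R dS * borel 'rV[R]_dA)).
Proof.
move=> tT; apply: (measurableX (measurable_aug_states HM tT)).
exact: measurable_controls.
Qed.

Lemma action_at_lt (z : trajectory M) t : (t < T)%N ->
  action_at z t = (nth point z.1 t).1.
Proof.
move=> tT; rewrite /action_at nth_rcons size_map size_tuple tT.
by rewrite (nth_map point)// size_tuple.
Qed.

Lemma action_at_horizon (z : trajectory M) : action_at z T = z.2.
Proof. by rewrite /action_at nth_rcons size_map size_tuple ltnn eqxx. Qed.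

Lemma noise_at_lt (z : trajectory M) t : (t < T)%N ->
  noise_at z t = (nth point z.1 t).2.
Proof. by move=> tT; rewrite /noise_at (nth_map point)// size_tuple. Qed.

Lemma feasible_trajectoryE (z : trajectory M) : feasible_trajectory z <->
  follows M s any_control T z.1 /\ controls M T z.2.
Proof.
split=> [[za zn]|[fz zT]].
  split=> [t tT|]; last by rewrite -action_at_horizon; exact: za.
  by rewrite -action_at_lt// -noise_at_lt//; split; [exact/za/ltnW|exact: zn].
split=> t tT; last by rewrite noise_at_lt//; case: (fz _ tT).
move: tT; rewrite leq_eqVlt => /predU1P[->|tT]; first by rewrite action_at_horizon.
by rewrite action_at_lt//; case: (fz _ tT).
Qed.

(** The second augmented component accumulates the costs of the first [T] stages; the cost of the
    last action, which has no noise after it, is added separately. *)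
Lemma total_costE (z : trajectory M) : total_cost s z =
  (aug_at M s z.1 T).2 + cost M T (aug_at M s z.1 T).1 z.2.
Proof.
have stateE t : (t <= T)%N -> state_at s z t = (aug_at M s z.1 t).1 /\
    \sum_(i < t) cost M i (state_at s z i) (action_at z i) =
      (aug_at M s z.1 t).2.
  elim: t => [_|t IH tT]; first by rewrite big_ord0.
  have [IHs IHx] := IH (ltnW tT).
  by rewrite big_ord_recr/= IHx IHs action_at_lt// noise_at_lt.
have [sE xE] := stateE T (leqnn _).
by rewrite /total_cost big_ord_recr/= xE sE action_at_horizon.
Qed.

Let any_control_sub t y : (t <= T)%N -> aug_states M t y ->
  any_control t y `<=` controls M t.
Proof. by move=> ? ? a. Qed.

Lemma feasible_aug_state (z : trajectory M) : feasible_trajectory z ->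
  aug_states M T (aug_at M s z.1 T).
Proof. by move=> /feasible_trajectoryE[+ _]; exact: follows_aug_states. Qed.

Lemma feasible_total_cost_itv (z : trajectory M) :
  feasible_trajectory z -> total_cost s z \in `[0, T.+1%:R].
Proof.
move=> fz; rewrite total_costE in_itv/=; apply: aug_cost_itv => //.
  exact: feasible_aug_state.
by case/feasible_trajectoryE: fz.
Qed.

Let measurable_feasible_prefix :=
  measurable_follows HM any_control_sub s0 measurable_any_control
    (leqnn T) (leqnn T).

Lemma measurable_feasible : measurable (@feasible_trajectory R dS dA Xi M).
Proof.
rewrite (_ : @feasible_trajectory _ _ _ _ M =
  [set w : T.-tuple event | follows M s any_control T w] `*` controls M T).
  by apply: measurableX; [exact: measurable_feasible_prefix.1|
    exact: measurable_controls].
by apply/seteqP; split=> z; rewrite feasible_trajectoryE.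
Qed.

Lemma measurable_total_cost :
  measurable_fun (@feasible_trajectory R dS dA Xi M) (total_cost s).
Proof.
have [mF mY] := measurable_feasible_prefix.
apply: (eq_measurable_fun (fun z : trajectory M => (aug_at M s z.1 T).2 +
    cost M T (aug_at M s z.1 T).1 z.2)).
  by move=> z _; rewrite total_costE.
apply: (measurable_aug_cost_comp HM (y := fun z : trajectory M => aug_at M s z.1 T)
  (a := snd)) => //.
- apply: (measurable_comp mF _ mY); last exact: measurable_funTS.
  by move=> _ [z /feasible_trajectoryE[fz _] <-].
- exact: measurable_funTS.
- by move=> z /feasible_aug_state.
- by move=> z /feasible_trajectoryE[].
Qed.

(** * Monotonicity of the shifted value integrals along the stages *)

Section chain.
Variables (pi : policy R dA Xi) (sel : nat -> aug_state R dS -> set 'rV[R]_dA).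
Hypothesis sel_sub : forall t y, (t <= T)%N -> aug_states M t y ->
  sel t y `<=` controls M t.
Hypothesis msel : forall t, (t <= T)%N -> measurable
  ([set z | aug_states M t z.1 /\ sel t z.1 z.2] :
     set (aug_state R dS * borel 'rV[R]_dA)).
Hypothesis pi_sel : forall t, (t <= T)%N -> forall w : t.-tuple event,
  follows M s sel t w -> action_kernel pi t w (sel t (aug_at M s w t)) = 1%E.
Local Notation followers t :=
  [set w : t.-tuple event | follows M s sel t w].

Local Open Scope ereal_scope.

Local Notation steps t := [set z : t.-tuple event * borel 'rV[R]_dA |
  follows M s sel t z.1 /\ sel t (aug_at M s z.1 t) z.2].

Let mG t : (t <= T)%N -> measurable (steps t).
Proof.
move=> tT; have [mF mY] := measurable_follows HM sel_sub s0 msel (leqnn t) tT.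
have mD : measurable (followers t `*` [set: borel 'rV[R]_dA]).
  exact: measurableX.
have mp : measurable_fun (followers t `*` [set: borel 'rV[R]_dA])
    (fun z : t.-tuple event * borel 'rV[R]_dA => (aug_at M s z.1 t, z.2)).
  apply: measurable_fun_pair_dom; last exact: measurable_funTS.
  apply: (measurable_comp mF _ mY); last exact: measurable_funTS.
  by move=> _ [z [fz _] <-].
rewrite (_ : steps t = (followers t `*` setT) `&`
    (fun z : t.-tuple event * borel 'rV[R]_dA => (aug_at M s z.1 t, z.2)) @^-1`
      [set z | aug_states M t z.1 /\ sel t z.1 z.2]); first exact: mp (msel tT).
apply/seteqP; split=> [[w a] [/= fw sa]|[w a] [[/= fw _] [_ sa]]] //.
by split => //; split => //; exact: (follows_aug_states HM sel_sub s0 tT fw).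
Qed.

Let GP t (w : t.-tuple event) : (t <= T)%N -> follows M s sel t w ->
  action_kernel pi t w (xsection (steps t) w) = 1.
Proof.
move=> tT fw; rewrite -(pi_sel tT fw); congr (action_kernel pi t w _).
apply/seteqP; split=> a; first by move=> /xsectionP[].
by move=> sa; apply/xsectionP.
Qed.

(** The law of the longer prefix is an image of a semidirect product times the noise law. A change
    of variables and Tonelli isolate the noise integral, which [JJ'] bounds below; the action is
    then integrated out over [steps t]. *)
Lemma le_integral_prefix (t : nat) (J J' : aug_state R dS -> R) : (t < T)%N ->
  measurable_fun (aug_states M t) J -> measurable_fun (aug_states M t.+1) J' ->
  (forall y, aug_states M t y -> (0 <= J y)%R) ->
  (forall y, aug_states M t.+1 y -> (0 <= J' y)%R) ->
  (forall y a, aug_states M t y -> sel t y a -> (J y)%:E <=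
    \int[noise_law M t]_(xi in noises M t) (J' (aug_trans M t y a xi))%:E) ->
  \int[prefix_law M pi t]_(w in followers t) (J (aug_at M s w t))%:E <=
  \int[prefix_law M pi t.+1]_(w in followers t.+1) (J' (aug_at M s w t.+1))%:E.
Proof.
move=> lt_tT mJ mJ' J0 J'0 JJ'; have tT := ltnW lt_tT.
have [mF mY] := measurable_follows HM sel_sub s0 msel (leqnn t) tT.
have [mF' mY'] := measurable_follows HM sel_sub s0 msel (leqnn t.+1) lt_tT.
have YS (w : t.-tuple event) : follows M s sel t w -> aug_states M t (aug_at M s w t).
  exact: (follows_aug_states HM sel_sub s0).
have YS' (w : t.+1.-tuple event) : follows M s sel t.+1 w ->
    aug_states M t.+1 (aug_at M s w t.+1).
  exact: (follows_aug_states HM sel_sub s0).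
(* Extension by zero makes the integrand total and nonnegative, as the change of variables and
   Tonelli require. *)
rewrite [leRHS]integral_mkcond.
set q := (X in \int[_]_w X w).
have mq : measurable_fun setT q.
  apply/(measurable_restrictT _ mF')/measurable_EFinP.
  apply: (measurable_comp _ _ mJ' mY'); first exact: measurable_aug_states.
  by move=> _ [w /= fw <-]; exact: YS'.
have q0 w : 0 <= q w.
  by rewrite /q patchE; case: ifPn => // /set_mem/YS'/J'0; rewrite lee_fin.
have mqr : measurable_fun setT (q \o @rcons_pair _ _ _ _ t).
  exact: measurableT_comp mq (@measurable_rcons_pair _ _ _ _ _).
rewrite [leRHS]/= ge0_integral_distribution// fubini_tonelli1//; last first.
  by move=> z; exact: q0.
apply: (@le_integral_semidirect _ _ _ _ _ _ _ _ (steps t)) => //.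
- exact: mG.
- apply/measurable_EFinP; apply: (measurable_comp _ _ mJ mY).
    exact: measurable_aug_states.
  by move=> _ [w /= fw <-]; exact: YS.
- by move=> w fw; rewrite lee_fin; exact/J0/YS.
- apply: measurable_fun_fubini_tonelli_F => // z; exact: q0.
- by move=> z; apply: integral_ge0 => xi _; exact: q0.
- by move=> w fw; exact: GP.
move=> w a fw [_ /= sa]; apply: le_trans (JJ' _ _ (YS _ fw) sa) _.
rewrite integral_mkcond /fubini_F le_eqVlt; apply/predU1P; left.
apply: eq_integral => xi _ /=.
(* Past and action being already legitimate, the extended prefix follows [sel] exactly when the new
   noise is feasible, so the inner integral is over [noises M t]. *)
have fE : follows M s sel t.+1 (rcons w (a, xi)) = noises M t xi.
  have := follows_rcons M s sel w (a, xi); rewrite !size_tuple => fP.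
  by apply/propext; split=> [/fP[_ []]//|nxi]; exact/fP.
rewrite /q !patchE; congr (if _ then _ else _); last first.
  rewrite /= aug_at_rcons ?size_tuple// nth_rcons size_tuple ltnn eqxx.
  by [].
by apply/asboolP/asboolP => /=; rewrite fE.
Qed.

Lemma le_integral_prefix_chain (J : nat -> aug_state R dS -> R) :
  (forall t, (t <= T)%N -> measurable_fun (aug_states M t) (J t)) ->
  (forall t y, (t <= T)%N -> aug_states M t y -> (0 <= J t y)%R) ->
  (forall t y a, (t < T)%N -> aug_states M t y -> sel t y a -> (J t y)%:E <=
    \int[noise_law M t]_(xi in noises M t)
      (J t.+1 (aug_trans M t y a xi))%:E) ->
  (J 0%N (s, 0%R))%:E <=
    \int[prefix_law M pi T]_(w in followers T) (J T (aug_at M s w T))%:E.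
Proof.
move=> mJ J0 JJ; suff : forall t, (t <= T)%N -> (J 0%N (s, 0%R))%:E <=
    \int[prefix_law M pi t]_(w in followers t) (J t (aug_at M s w t))%:E.
  exact.
elim=> [_|t IH tT]; last first.
  apply: le_trans (IH (ltnW tT)) _; apply: le_integral_prefix => //.
  - exact: mJ (ltnW tT).
  - exact: mJ.
  - by move=> y; apply: J0; exact: ltnW.
  - by move=> y; exact: J0.
  - by move=> y a; exact: JJ.
(* The initial prefix law is the Dirac mass at the empty tuple, whose augmented state is
   [(s, 0)]. *)
have F0 : followers 0 = setT by apply/seteqP.
by rewrite F0 /= integral_dirac//= diracT mul1e.
Qed.

Variables (phi : R -> R) (L : R).
Hypothesis Hphi : forall z z' : R, z \in `[0%R, T.+1%:R] ->
  z' \in `[0%R, T.+1%:R] -> (`|phi z - phi z'| <= L * `|z - z'|)%R.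
Variable g : nat -> aug_state R dS -> borel 'rV[R]_dA.
Hypothesis Hg : minimizing_selector M phi g.

Let L0 : (0 <= L)%R. Proof. exact: lipschitz_cst_ge0 Hphi. Qed.

(** [L *+ T.+1] bounds the dynamic programming values at all stages, the other summand bounds [phi]
    on the interval; [B] thus serves for [phi] and [dp_phi] alike. *)
Let B : R := (L *+ T.+1 + (`|phi 0| + L * T.+1%:R))%R.

Let phiB z : z \in `[0%R, T.+1%:R] -> (`|phi z| <= B)%R.
Proof.
by move=> zI; rewrite (le_trans (phi_bounded Hphi zI))// lerDr mulrn_wge0.
Qed.

(** Augmented costs are increments of [phi] and telescope; adding [phi] of the accumulated cost
    restores the Bellman value for [phi] of the total cost. *)
Let dp_phi t (y : aug_state R dS) := (dp_value M phi t y + phi y.2)%R.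

Let dp_phiB t y : (t <= T)%N -> aug_states M t y -> (`|dp_phi t y| <= B)%R.
Proof.
move=> tT Sy; rewrite (le_trans (ler_normD _ _))// lerD//.
  have [_ /(_ y Sy) /le_trans] := dp_value_measurable_bounded HM Hphi Hg tT.
  by apply; rewrite ler_wpMn2l// ltnS leq_subr.
by apply: (phi_bounded Hphi); apply: (@phi_itv_sub _ _ _ _ _ t);
  [exact: leqW|case: Sy].
Qed.

Lemma measurable_phi_total_cost :
  measurable_fun (@feasible_trajectory R dS dA Xi M) (phi \o total_cost s).
Proof.
apply: (measurable_phi_comp Hphi measurable_total_cost) => z.
exact: feasible_total_cost_itv.
Qed.

(* With [e = 1] and all controls this bounds values from below, with [e = -1]
   and the actions of the minimizing selector it bounds them from above. *)
Lemma verification (e : R) :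
  (forall t y a, (t <= T)%N -> aug_states M t y -> sel t y a ->
    (e * dp_value M phi t y <=
     e * bellman_obj M phi t (dp_value M phi t.+1) y a)%R) ->
  (e * (dp_value M phi 0 (s, 0) + phi 0) <= e * value M phi pi s)%R.
Proof.
move=> opt; pose K := (`|e| * B)%R.
pose J t y := (K + e * dp_phi t y)%R.
have K0 (x : R) : (`|x| <= B -> 0 <= K + e * x)%R.
  move=> xB; rewrite -lerBlDr sub0r (le_trans (ler_norm _))// normrN normrM.
  exact: ler_wpM2l.
have mJ t : (t <= T)%N -> measurable_fun (aug_states M t) (J t).
  move=> tT; apply: measurable_funD => //; apply: measurable_funM => //.
  have [mdp _] := dp_value_measurable_bounded HM Hphi Hg tT.
  apply: measurable_funD => //.
  apply: (measurable_phi_comp Hphi (measurable_funTS measurable_snd)).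
  by move=> y Sy; apply: (@phi_itv_sub _ _ _ _ _ t); [exact: leqW|case: Sy].
have J0 t y : (t <= T)%N -> aug_states M t y -> (0 <= J t y)%R.
  by move=> tT Sy; exact/K0/dp_phiB.
have JJ t y a : (t < T)%N -> aug_states M t y -> sel t y a -> (J t y)%:E <=
    \int[noise_law M t]_(xi in noises M t)
      (J t.+1 (aug_trans M t y a xi))%:E.
  move=> lt_tT Sy sa; have tT := ltnW lt_tT.
  have Aa := sel_sub tT Sy sa.
  have mN := noises_measurable HM lt_tT.
  have [mdp dpb] := dp_value_measurable_bounded HM Hphi Hg lt_tT.
  have mnext := measurable_next HM (fun=> mdp) lt_tT Sy Aa.
  (* The next accumulated cost does not depend on the noise, so [phi c] comes out of the integral as
     a constant, [noises M t] having mass 1. *)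
  pose c := (y.2 + cost M t y.1 a)%R.
  have iW : (noise_law M t).-integrable (noises M t)
      (EFin \o (fun xi => dp_value M phi t.+1 (aug_trans M t y a xi))).
    apply: (@bounded_integrable _ _ _ _ _ _ (L *+ (T - t.+1).+1)) => // xi Nxi.
    exact/dpb/aug_trans_states.
  have iN : (noise_law M t).-integrable (noises M t) (EFin \o cst (K + e * phi c)%R).
    apply: (@bounded_integrable _ _ _ _ _ _ (`|K + e * phi c|%R)) => //.
  pose h (xi : borel Xi) : R := (K + e * phi c +
    e * dp_value M phi t.+1 (aug_trans M t y a xi))%R.
  rewrite (eq_integral (EFin \o h)); last first.
    by move=> xi _ /=; rewrite /h /J /dp_phi/= -/c; congr EFin; ring.
  have ieW : (noise_law M t).-integrable (noises M t) (EFin \o (fun xi =>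
      e * dp_value M phi t.+1 (aug_trans M t y a xi))%R) := integrableZl mN e iW.
  have ih := integrableD mN iN ieW.
  rewrite -(fineK (integrable_fin_num mN ih)) lee_fin.
  rewrite -[leRHS]/(Rintegral _ _ h) RintegralD//.
  rewrite Rintegral_cst// (congr1 fine (noise_law_supp HM lt_tT))/= mulr1 RintegralZl//.
  have := opt t y a tT Sy sa; rewrite /bellman_obj lt_tT /aug_cost -/c.
  by rewrite /J /dp_phi; lra.
have [mF mY] := measurable_follows HM sel_sub s0 msel (leqnn T) (leqnn T).
have mfeas := measurable_feasible.
have mphi := measurable_phi_total_cost.
have feasB (z : trajectory M) : feasible_trajectory z -> (`|phi (total_cost s z)| <= B)%R.
  by move=> fz; exact: phiB (feasible_total_cost_itv fz).
pose v (z : trajectory M) := (K + e * phi (total_cost s z))%R.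
have mv : measurable_fun (@feasible_trajectory R dS dA Xi M) v.
  by apply: measurable_funD => //; exact: measurable_funM.
(* One more semidirect step draws the last action. At stage [T] the Bellman objective is the
   augmented cost alone, and adding [phi] of the accumulated cost turns it into [phi] of the total
   cost. *)
have vge0 : (J 0%N (s, 0%R))%:E <=
    \int[trajectory_law M pi]_(z in @feasible_trajectory R dS dA Xi M) (v z)%:E.
  apply: le_trans (le_integral_prefix_chain mJ J0 JJ) _.
  rewrite [leRHS]integral_mkcond /trajectory_law.
  apply: (@le_integral_semidirect _ _ _ _ _ _ _ _ (steps T)) => //.
  - exact: mG.
  - apply/measurable_EFinP; apply: (measurable_comp _ _ (mJ T (leqnn T)) mY).
      exact: measurable_aug_states.
    by move=> _ [w /= fw <-]; exact: (follows_aug_states HM sel_sub s0).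
  - move=> w fw; rewrite lee_fin; apply: J0 => //.
    exact: (follows_aug_states HM sel_sub s0).
  - exact/(measurable_restrictT _ mfeas)/measurable_EFinP.
  - move=> z; rewrite patchE; case: ifPn => // /set_mem fz.
    by rewrite lee_fin; exact/K0/feasB.
  - by move=> w fw; exact: GP.
  move=> w a fw [_ /= sa].
  have SY := follows_aug_states HM sel_sub s0 (leqnn T) fw.
  have fz : feasible_trajectory ((w, a) : trajectory M).
    apply/feasible_trajectoryE; split => /=; last exact: sel_sub sa.
    move=> i iT; have [si ni] := fw i iT; split => //.
    apply: sel_sub si; first exact: ltnW.
    apply: (follows_aug_states HM sel_sub s0 (ltnW iT)) => j ji.
    exact/fw/(ltn_trans ji).
  rewrite patchE mem_set// lee_fin /v total_costE/= /J /dp_phi.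
  have := opt T _ a (leqnn T) SY sa; rewrite /bellman_obj ltnn addr0 /aug_cost.
  by lra.
have iphi : (trajectory_law M pi).-integrable (@feasible_trajectory R dS dA Xi M)
    (EFin \o (phi \o total_cost s)).
  by apply: (@bounded_integrable _ _ _ _ _ _ B).
have iK : (trajectory_law M pi).-integrable (@feasible_trajectory R dS dA Xi M)
    (EFin \o cst K).
  by apply: (@bounded_integrable _ _ _ _ _ _ (`|K|%R)).
have iephi : (trajectory_law M pi).-integrable
    (@feasible_trajectory R dS dA Xi M)
    (EFin \o (fun z => e * phi (total_cost s z))%R) := integrableZl mfeas e iphi.
have iv := integrableD mfeas iK iephi.
move: vge0; rewrite -(fineK (integrable_fin_num mfeas iv)) lee_fin.
rewrite -[leRHS]/(Rintegral _ _ v) RintegralD//.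
rewrite Rintegral_cst// RintegralZl// -/(value M phi pi s) /J /dp_phi/=.
(* On the right [K] is multiplied by the mass of the feasible trajectories; as [K >= 0] and this
   mass is at most 1, [K] cancels in the favourable direction. *)
have K00 : (0 <= K)%R by rewrite mulr_ge0// addr_ge0 ?mulrn_wge0// addr_ge0 ?mulr_ge0.
have p1 : (fine (trajectory_law M pi (@feasible_trajectory R dS dA Xi M)) <= 1)%R.
  by rewrite -lee_fin fineK ?probability_le1//; exact: fin_num_measure.
have := ler_wpM2l K00 p1; rewrite mulr1; lra.
Qed.

End chain.
End verification.

(** * The policy that plays the minimizing selector *)

Section closed_loop_policies.
Context (R : realType) (dS dA : nat) (Xi : ptopologicalType).
Variables (M : soc R dS dA Xi) (HM : soc_assumptions M).
Local Notation T := (horizon M).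
Local Notation event := (borel 'rV[R]_dA * borel Xi)%type.
Variables (s : 'rV[R]_dS) (s0 : states M 0 s).
Variables (phi : R -> R) (g : nat -> aug_state R dS -> borel 'rV[R]_dA).
Hypothesis Hg : minimizing_selector M phi g.

Definition selected (t : nat) (y : aug_state R dS) : set 'rV[R]_dA := [set g t y].

Lemma selected_sub t y : (t <= T)%N -> aug_states M t y ->
  selected t y `<=` controls M t.
Proof. by move=> tT Sy a ->; have [_ /(_ y Sy)[]] := Hg tT. Qed.

(** The graph of [g t] is the common zero set of the finitely many real functions comparing the
    coordinates of the action with those of [g t]. *)
Lemma measurable_selected t : (t <= T)%N -> measurable
  ([set z | aug_states M t z.1 /\ selected t z.1 z.2] :
     set (aug_state R dS * borel 'rV[R]_dA)).
Proof.
move=> tT; have [mg _] := Hg tT; have mS := measurable_aug_states HM tT.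
have mD : measurable (aug_states M t `*` [set: borel 'rV[R]_dA]).
  exact: measurableX.
rewrite (_ : mkset _ = (aug_states M t `*` setT) `&`
    \bigcap_(i in [set: 'I_dA]) ((aug_states M t `*` setT) `&`
      (fun z : aug_state R dS * borel 'rV[R]_dA =>
        (z.2 : 'rV[R]_dA) ord0 i - (g t z.1 : 'rV[R]_dA) ord0 i) @^-1` [set 0])).
  apply: measurableI => //.
  apply: fin_bigcap_measurable => [|i _]; first exact: finite_finset.
  have mi : measurable_fun (aug_states M t `*` [set: borel 'rV[R]_dA])
      (fun z => (z.2 : 'rV[R]_dA) ord0 i - (g t z.1 : 'rV[R]_dA) ord0 i).
    apply: measurable_funB.
      apply: (measurableT_comp (measurable_coord i)).
      exact: measurable_funTS measurable_snd.
    apply: (measurableT_comp (measurable_coord i)).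
    apply: (measurable_comp mS _ mg); last exact: measurable_funTS.
    by move=> _ [z [Sz _] <-].
  exact: mi.
apply/seteqP; split=> [[y a] [/= Sy ->]|[y a] [/= [Sy _] eqa]].
  by split=> // i _; split => //=; rewrite subrr.
split=> //; apply/rowP => i.
by have [_ /= /eqP] := eqa i I; rewrite subr_eq0 => /eqP.
Qed.

Definition feasible_histories t : set (t.-tuple (borel Xi)) :=
  [set h | forall i, (i < t)%N -> noises M i (nth point h i)].

Lemma feasible_historyP t (h : t.-tuple Xi) :
  feasible_history M h <-> feasible_histories h.
Proof.
split=> [fh i it|fh i]; last by rewrite (tnth_nth point); exact: fh.
by have := fh (Ordinal it); rewrite (tnth_nth point).
Qed.

Lemma measurable_feasible_histories t : (t <= T)%N ->
  measurable (@feasible_histories t).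
Proof.
move=> tT; rewrite (_ : @feasible_histories t = \bigcap_(i in [set i | (i < t)%N])
  (setT `&` (fun h : t.-tuple (borel Xi) => nth point h i) @^-1` noises M i)).
  apply: fin_bigcap_measurable => [|i /= it]; first exact: finite_II.
  apply: measurable_nth => //; apply: (noises_measurable HM).
  exact: leq_trans it tT.
by apply/seteqP; split=> h fh i it; [split => //|]; have := fh i it => // -[].
Qed.

Lemma closed_loop_aug_states t (h : t.-tuple (borel Xi)) i : (t <= T)%N ->
  feasible_histories h -> (i <= t)%N ->
  aug_states M i (closed_loop M g s h i).
Proof.
move=> tT fh; elim: i => [_|i IH it] /=.
  by split => //=; rewrite in_itv/= lexx.
have iT := leq_trans it tT; have Si := IH (ltnW it).
by apply: aug_trans_states => //; [exact: selected_sub (ltnW iT) Si _ _|exact: fh].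
Qed.

Lemma measurable_closed_loop t i : (t <= T)%N -> (i <= t)%N ->
  measurable_fun (@feasible_histories t)
    (fun h : t.-tuple (borel Xi) => closed_loop M g s h i).
Proof.
move=> tT; elim: i => [_|i IH it] /=; first exact: measurable_cst.
have iT := leq_trans it tT; have mi := IH (ltnW it).
have [mg _] := Hg (ltnW iT).
have Si (h : t.-tuple (borel Xi)) : feasible_histories h ->
    aug_states M i (closed_loop M g s h i).
  by move=> fh; exact: closed_loop_aug_states tT fh (ltnW it).
apply: (measurable_aug_trans_comp HM (a := fun h : t.-tuple (borel Xi) =>
    g i (closed_loop M g s h i)) mi _ Si _ iT) => //.
- apply: (measurable_comp _ _ mg mi); first exact: measurable_aug_states (ltnW iT).
  by move=> _ [h fh <-]; exact: Si.
- by move=> h fh; exact: selected_sub (ltnW iT) (Si _ fh) _ _.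
- exact: measurable_funTS (measurable_nth it).
- by move=> h fh; exact: fh.
Qed.

(** The default action off the feasible histories and after [T] yields a total measurable map: the
    closed loop is known to be measurable on the feasible histories only. *)
Definition closed_loop_action t (h : t.-tuple (borel Xi)) : borel 'rV[R]_dA :=
  if (t <= T)%N
  then ((fun h : t.-tuple (borel Xi) => g t (closed_loop M g s h t))
        \_ (@feasible_histories t)) h
  else point.

Lemma measurable_closed_loop_action t :
  measurable_fun setT (@closed_loop_action t).
Proof.
rewrite /closed_loop_action; have [tT|_] := leqP t T; last exact: measurable_cst.
apply/(measurable_restrictT _ (measurable_feasible_histories tT)).
have [mg _] := Hg tT.
apply: (measurable_comp _ _ mg (measurable_closed_loop tT (leqnn t))).
  exact: measurable_aug_states.
by move=> _ [h fh <-]; exact: closed_loop_aug_states.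
Qed.

Definition closed_loop_policy : policy R dA Xi :=
  fun t => kdirac (@measurable_closed_loop_action t).

Lemma closed_loop_policy_implements : implements M closed_loop_policy g s.
Proof.
move=> t tT h /feasible_historyP fh U mU.
by rewrite /closed_loop_policy/= /kdirac /closed_loop_action tT patchE mem_set.
Qed.

Lemma closed_loop_policy_admissible : admissible M closed_loop_policy.
Proof.
move=> t tT h fh; rewrite closed_loop_policy_implements//; last first.
  exact: measurable_controls.
rewrite diracE mem_set//; move/feasible_historyP: fh => fh.
exact: selected_sub (closed_loop_aug_states tT fh (leqnn t)) _ _.
Qed.

(** When the recorded actions are those of [g], the state rebuilt from the noises alone is the
    actual one; this links policies, which see noise histories, with prefixes, which also record
    actions. *)
Lemma follows_selected_closed_loop t (w : t.-tuple event) i :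
  follows M s selected t w -> (i <= t)%N ->
  closed_loop M g s (snd_tup w) i = aug_at M s w i.
Proof.
move=> fw; elim: i => //= i IH it; rewrite IH; last exact: ltnW.
by have [-> _] := fw i it; rewrite (nth_map point) ?size_tuple.
Qed.

Lemma follows_feasible_history sel t (w : t.-tuple event) :
  follows M s sel t w -> feasible_history M (snd_tup w).
Proof.
move=> fw; apply/feasible_historyP => i it.
by rewrite (nth_map point) ?size_tuple//; case: (fw i it).
Qed.

Lemma implements_selected pi : implements M pi g s ->
  forall t, (t <= T)%N -> forall w : t.-tuple event, follows M s selected t w ->
  action_kernel pi t w (selected t (aug_at M s w t)) = 1%E.
Proof.
move=> Hpi t tT w fw; rewrite /action_kernel/= /kpullback.
rewrite Hpi//; last 2 first.
- exact: follows_feasible_history fw.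
- exact: compact_measurable_borel (@compact_set1 'rV[R]_dA (g t _)).
by rewrite (follows_selected_closed_loop fw)// diracE mem_set.
Qed.

Lemma admissible_any_control pi : admissible M pi ->
  forall t, (t <= T)%N -> forall w : t.-tuple event,
  follows M s (any_control M) t w ->
  action_kernel pi t w (any_control M t (aug_at M s w t)) = 1%E.
Proof.
move=> Hpi t tT w fw; apply: Hpi => //; exact: follows_feasible_history fw.
Qed.

Variable (L : R).
Hypothesis Hphi : forall z z' : R, z \in `[0, T.+1%:R] ->
  z' \in `[0, T.+1%:R] -> `|phi z - phi z'| <= L * `|z - z'|.

Lemma value_ge_dp pi : admissible M pi ->
  dp_value M phi 0 (s, 0) + phi 0 <= value M phi pi s.
Proof.
move=> Hpi; rewrite -[leLHS]mul1r -[leRHS]mul1r.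
apply: (verification HM s0 _ (measurable_any_control HM)
  (admissible_any_control Hpi) Hphi Hg) => //.
  by move=> ? ? _ _ ?.
by move=> t y a tT Sy Aa; rewrite !mul1r; exact: (dp_value_le_bellman HM Hphi Hg).
Qed.

(** The selected action attains the Bellman minimum, so the hypothesis of [verification] holds with
    equality and may be used with [e = -1]. *)
Lemma value_implements_le_dp pi : implements M pi g s ->
  value M phi pi s <= dp_value M phi 0 (s, 0) + phi 0.
Proof.
move=> Hpi; rewrite -lerN2 -mulN1r -[leRHS]mulN1r.
apply: (verification HM s0 selected_sub measurable_selected
  (implements_selected Hpi) Hphi Hg) => t y a tT Sy ->.
by have [_ /(_ y Sy)[_ ->]] := Hg tT.
Qed.

End closed_loop_policies.

(** Uniform in the policy, this bound makes the infimum over policies a genuine lower bound. *)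
Lemma value_bounded (R : realType) (dS dA : nat) (Xi : ptopologicalType)
    (M : soc R dS dA Xi) (HM : soc_assumptions M) (s : 'rV[R]_dS)
    (s0 : states M 0 s) (phi : R -> R) (L : R)
    (Hphi : forall z z' : R, z \in `[0, (horizon M).+1%:R] ->
      z' \in `[0, (horizon M).+1%:R] -> `|phi z - phi z'| <= L * `|z - z'|)
    (pi : policy R dA Xi) :
  `|value M phi pi s| <= `|phi 0| + L * (horizon M).+1%:R.
Proof.
apply: bounded_normr_Rintegral.
- exact: (measurable_feasible HM s0).
- exact: (measurable_phi_total_cost HM s0 Hphi).
- by move=> z fz; apply: (phi_bounded Hphi); exact: feasible_total_cost_itv.
- by rewrite addr_ge0// mulr_ge0//; exact: lipschitz_cst_ge0 Hphi.
Qed.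

(** * Exchange of the minima over parameters and policies *)

Theorem theorem3p1 (R : realType) (dS dA dTheta : nat) (Xi : ptopologicalType)
    (M : soc R dS dA Xi) (HM : soc_assumptions M)
    (Theta : set 'rV[R]_dTheta) (f : 'rV[R]_dTheta -> R -> R)
    (LC LTheta RTheta : R)
    (Hf_cost : forall theta (z z' : R), Theta theta ->
       z \in `[0, (horizon M).+1%:R] -> z' \in `[0, (horizon M).+1%:R] ->
       `|f theta z - f theta z'| <= LC * `|z - z'|)
    (Hf_theta : forall theta theta' (z : R), Theta theta -> Theta theta' ->
       z \in `[0, (horizon M).+1%:R] ->
       `|f theta z - f theta' z| <= LTheta * euclidean_norm (theta - theta'))
    (HTheta : forall theta, Theta theta -> euclidean_norm theta <= RTheta)
    (s : 'rV[R]_dS) (Hs : states M 0 s)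
    (theta_star : 'rV[R]_dTheta) (Htheta_star : Theta theta_star)
    (Hopt : forall theta, Theta theta ->
       optimal_value M (f theta_star) s <= optimal_value M (f theta) s)
    (g : nat -> aug_state R dS -> borel 'rV[R]_dA)
    (Hg : minimizing_selector M (f theta_star) g) :
  is_minimum [set risk M Theta f pi s | pi in admissible M]
    (dp_value M (f theta_star) 0 (s, 0) + f theta_star 0) /\
  (exists pi, admissible M pi /\ implements M pi g s) /\
  (forall pi_star, admissible M pi_star -> implements M pi_star g s ->
     forall pi, admissible M pi ->
       risk M Theta f pi_star s <= risk M Theta f pi s).
Proof.
set v := dp_value M (f theta_star) 0 (s, 0) + f theta_star 0.
have Lip theta : Theta theta -> forall z z' : R,
    z \in `[0, (horizon M).+1%:R] -> z' \in `[0, (horizon M).+1%:R] ->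
    `|f theta z - f theta z'| <= LC * `|z - z'|.
  by move=> Ht z z'; exact: Hf_cost.
have Lip_star := Lip _ Htheta_star.
pose pig := closed_loop_policy HM Hs Hg.
have pig_adm : admissible M pig := closed_loop_policy_admissible HM Hs Hg.
have pig_impl : implements M pig g s := closed_loop_policy_implements HM Hs Hg.
have v_opt : v <= optimal_value M (f theta_star) s.
  apply: lb_le_inf; first by exists (value M (f theta_star) pig s), pig.
  by move=> _ [pi Hpi <-]; exact: (value_ge_dp HM Hs Hg Lip_star).
(* Here the two minima are exchanged: optimality of [theta_star] compares optimal values over
   policies, and each of these lies below every value at its own parameter. *)
have v_le theta pi : Theta theta -> admissible M pi ->
    v <= value M (f theta) pi s.
  move=> Ht Hpi; rewrite (le_trans v_opt)// (le_trans (Hopt _ Ht))//.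
  apply: ge_inf; last by exists pi.
  exists (- (`|f theta 0| + LC * (horizon M).+1%:R)) => _ [pi' _ <-].
  by have := value_bounded HM Hs (Lip _ Ht) pi'; rewrite ler_norml => /andP[].
have v_risk pi : admissible M pi -> v <= risk M Theta f pi s.
  move=> Hpi; apply: lb_le_inf.
    by exists (value M (f theta_star) pi s), theta_star.
  by move=> _ [theta Ht <-]; exact: v_le.
have risk_v pi : admissible M pi -> implements M pi g s ->
    risk M Theta f pi s <= v.
  move=> Hpi Ipi; apply: (@le_trans _ _ (value M (f theta_star) pi s)).
    apply: ge_inf; last by exists theta_star.
    (* The set of values over [Theta] is bounded below by [v] itself, so its infimum is at most the
       value at [theta_star]. *)
    by exists v => _ [theta Ht <-]; exact: v_le.
  exact: (value_implements_le_dp HM Hs Hg Lip_star Ipi).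
split; [split|split].
- exists pig => //; apply/le_anti.
  by rewrite risk_v//= v_risk.
- by move=> _ [pi Hpi <-]; exact: v_risk.
- by exists pig.
- by move=> pi Hpi Ipi pi' Hpi'; rewrite (le_trans (risk_v _ Hpi Ipi))// v_risk.
Qed.
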